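(* Let $A\subseteq\mathbb B(H)$ be a commutative von Neumann algebra, let $M=(m_{jk})_{j,k\in\mathbb N}$ be an infinite matrix with entries in $A$, and put $p_{jk}=(m_{jk}^*m_{jk})^{1/2}$. Suppose there are positive constants $B_c,B_r$ such that, for all $k\in\mathbb N$, the series $\sum_{j=1}^{\infty}p_{jk}$ converges in the strong operator topology with $\left\|(\text{strong})\sum_{j=1}^{\infty}p_{jk}\right\|\le B_c$, and, for all $j\in\mathbb N$, the series $\sum_{k=1}^{\infty}p_{jk}$ converges in the strong operator topology with $\left\|(\text{strong})\sum_{k=1}^{\infty}p_{jk}\right\|\le B_r$. Then the formula $$(L_M((a_k)_k))_j=\sum_{k=1}^{\infty}m_{jk}a_k,\qquad j\in\mathbb N,\ (a_k)_k\in\ell^2(A),$$ defines a bounded module map $L_M:\ell^2(A)\to\ell^2_{\mathrm{strong}}(A)$ that extends to an adjointable map $L_M:\ell^2_{\mathrm{strong}}(A)\to\ell^2_{\mathrm{strong}}(A)$ such that $\|L_M\|\le(B_rB_c)^{1/2}$.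
   Context: $\ell^2(A)=\{(a_n)_{n\in\mathbb N}: a_n\in A,\ \sum_n a_na_n^*\text{ converges in norm}\}$ with $\langle (a_n),(b_n)\rangle=\sum_n a_nb_n^*$. $\ell^2_{\mathrm{strong}}(A)=\{(a_n)_{n\in\mathbb N}: a_n\in A,\ \sup_N\|\sum_{n=1}^Na_na_n^*\|<\infty\}$, a Hilbert $A$-module with inner product $\langle (a_n),(b_n)\rangle=\text{(strong)}\sum_{n} a_nb_n^*$ (strong operator topology of $\mathbb B(H)$), containing $\ell^2(A)$. Both are left Hilbert $A$-modules; a module map is an $A$-linear map. *)

(* Defs.v *)
From mathcomp Require Export all_boot all_order all_algebra.
From mathcomp Require Export all_classical all_reals all_analysis.
From mathcomp.real_closed Require Export complex.

Set Implicit Arguments.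
Unset Strict Implicit.
Unset Printing Implicit Defensive.

Import Order.TTheory GRing.Theory Num.Theory.
Import numFieldNormedType.Exports.

Local Open Scope classical_set_scope.
Local Open Scope ring_scope.

(* A complex Hilbert space is a complete normed space H over R[i] with an inner
   product dot : {dot H for Num.conj} (linear in its first argument) satisfying
   dot x x = `|x| ^+ 2.  Norms of vectors take values in R[i]; [vnorm] brings
   them back to R.  Operators are plain functions H -> H, so that sums, scaling
   and the topology {ptws H -> H} are the library's pointwise ones. *)

Definition vnorm (R : realType) (H : completeNormedModType R[i]) (x : H) : \bar R :=
  (complex.Re `|x|)%:E.

(* Norm of a map f between the normed spaces (D, nX) and (Y, nY); it is +oo
   exactly when f is unbounded on the unit ball of D. *)
Definition map_norm (R : realType) (X Y : Type) (D : set X)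
    (nX : X -> \bar R) (nY : Y -> \bar R) (f : X -> Y) : \bar R :=
  ereal_sup [set nY (f x) | x in [set x | D x /\ (nX x <= 1)%E]].

Definition opnorm (R : realType) (H : completeNormedModType R[i]) (T : H -> H) :
    \bar R :=
  map_norm setT (@vnorm R H) (@vnorm R H) T.

Definition bounded_op (R : realType) (H : completeNormedModType R[i])
    (T : H -> H) : Prop :=
  linear T /\ (opnorm T < +oo)%E.

Definition is_adjoint (R : realType) (H : completeNormedModType R[i])
    (dot : {dot H for Num.conj}) (T S : H -> H) : Prop :=
  bounded_op S /\ forall x y, dot (T x) y = dot x (S y).

Definition adjoint (R : realType) (H : completeNormedModType R[i])
    (dot : {dot H for Num.conj}) (T : H -> H) : H -> H :=
  get [set S | is_adjoint dot T S].

(* In R[i], 0 <= z means that z is real and nonnegative. *)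
Definition positive_op (R : realType) (H : completeNormedModType R[i])
    (dot : {dot H for Num.conj}) (T : H -> H) : Prop :=
  bounded_op T /\ forall x, 0 <= dot (T x) x.

Definition sqrt_op (R : realType) (H : completeNormedModType R[i])
    (dot : {dot H for Num.conj}) (T : H -> H) : H -> H :=
  get [set S | positive_op dot S /\ S \o S = T].

Definition abs_op (R : realType) (H : completeNormedModType R[i])
    (dot : {dot H for Num.conj}) (T : H -> H) : H -> H :=
  sqrt_op dot (adjoint dot T \o T).

(* The strong operator topology is the topology of pointwise convergence. *)
Definition sot_series (R : realType) (H : completeNormedModType R[i])
    (T : nat -> H -> H) (S : H -> H) : Prop :=
  bounded_op S /\ {ptws, (fun N => \sum_(n < N) T n) @ \oo --> S}.

Definition sot_sum (R : realType) (H : completeNormedModType R[i])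
    (T : nat -> H -> H) : H -> H :=
  get [set S | sot_series T S].

Definition norm_series (R : realType) (H : completeNormedModType R[i])
    (T : nat -> H -> H) (S : H -> H) : Prop :=
  bounded_op S /\
  (fun N => opnorm (\sum_(n < N) T n - S)) @ \oo --> (0 : \bar R)%E.

Definition norm_sum (R : realType) (H : completeNormedModType R[i])
    (T : nat -> H -> H) : H -> H :=
  get [set S | norm_series T S].

(* A unital *-subalgebra of B(H), closed in B(H) for the strong operator
   topology. *)
Record von_neumann_algebra (R : realType) (H : completeNormedModType R[i])
    (dot : {dot H for Num.conj}) (A : set (H -> H)) : Prop := VonNeumannAlgebra {
  vn_bounded : A `<=` @bounded_op R H ;
  vn_id : A id ;
  vn_linear : forall (c : R[i]) S T, A S -> A T -> A (c *: S + T) ;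
  vn_comp : forall S T, A S -> A T -> A (S \o T) ;
  vn_adjoint : forall T, A T -> exists2 S, A S & is_adjoint dot T S ;
  vn_closed : forall T, bounded_op T ->
    closure (A : set {ptws H -> H}) (T : {ptws H -> H}) -> A T }.

Definition commutative_algebra (H : Type) (A : set (H -> H)) : Prop :=
  forall S T, A S -> A T -> S \o T = T \o S.

Definition l2 (R : realType) (H : completeNormedModType R[i])
    (dot : {dot H for Num.conj}) (A : set (H -> H)) : set (nat -> H -> H) :=
  [set a : nat -> H -> H | (forall n, A (a n)) /\
     exists S, norm_series (fun n => a n \o adjoint dot (a n)) S].

Definition l2_ip (R : realType) (H : completeNormedModType R[i])
    (dot : {dot H for Num.conj}) (a b : nat -> H -> H) : H -> H :=
  norm_sum (fun n => a n \o adjoint dot (b n)).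

Definition l2_norm (R : realType) (H : completeNormedModType R[i])
    (dot : {dot H for Num.conj}) (a : nat -> H -> H) : \bar R :=
  sqrte (opnorm (l2_ip dot a a)).

Definition l2strong (R : realType) (H : completeNormedModType R[i])
    (dot : {dot H for Num.conj}) (A : set (H -> H)) : set (nat -> H -> H) :=
  [set a : nat -> H -> H | (forall n, A (a n)) /\
     (ereal_sup (range (fun N : nat =>
        opnorm (\sum_(n < N) (a n \o adjoint dot (a n)))%R)) < +oo)%E].

Definition l2strong_ip (R : realType) (H : completeNormedModType R[i])
    (dot : {dot H for Num.conj}) (a b : nat -> H -> H) : H -> H :=
  sot_sum (fun n => a n \o adjoint dot (b n)).

Definition l2strong_norm (R : realType) (H : completeNormedModType R[i])
    (dot : {dot H for Num.conj}) (a : nat -> H -> H) : \bar R :=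
  sqrte (opnorm (l2strong_ip dot a a)).

Definition act (H : Type) (c : H -> H) (a : nat -> H -> H) : nat -> H -> H :=
  fun n => c \o a n.

(* Complex-linearity is included, since A contains the scalar operators. *)
Definition module_map (H : zmodType) (A : set (H -> H))
    (E F : set (nat -> H -> H))
    (L : (nat -> H -> H) -> (nat -> H -> H)) : Prop :=
  set_fun E F L /\
  forall c a b, A c -> E a -> E b -> L (act c a + b) = act c (L a) + L b.

Definition adjointable (R : realType) (H : completeNormedModType R[i])
    (dot : {dot H for Num.conj}) (A : set (H -> H))
    (L : (nat -> H -> H) -> (nat -> H -> H)) : Prop :=
  set_fun (l2strong dot A) (l2strong dot A) L /\
  exists2 L' : (nat -> H -> H) -> (nat -> H -> H),
    set_fun (l2strong dot A) (l2strong dot A) L' &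
    forall a b, l2strong dot A a -> l2strong dot A b ->
      l2strong_ip dot (L a) b = l2strong_ip dot a (L' b).

Definition matrix_map (R : realType) (H : completeNormedModType R[i])
    (m : nat -> nat -> H -> H) (a : nat -> H -> H) : nat -> H -> H :=
  fun j => norm_sum (fun k => m j k \o a k).

(* Main.v *)
(* The matrix acts on the columns (a_k x)_k, for each vector x separately.  Since
   A is commutative, every m_jk is normal, so with p_jk = |m_jk| the mixed Schwarz
   inequality |<m_jk v, y>|^2 <= <p_jk v, v> <p_jk y, y> holds for all v, y.  The
   Schur test follows: |sum_k m_jk v_k|^2 <= B_r sum_k <p_jk v_k, v_k>, and summing
   over j gives B_r B_c sum_k |v_k|^2.  As a_k and a_k^* commute,
   sum_k |a_k x|^2 = <sum_k a_k a_k^* x, x>, so these are exactly the estimates for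
   the module norms.  The hypotheses are symmetric under M |-> M^*, which provides
   the adjoint. *)
Require Import Defs.
From mathcomp Require Import ring lra.
Import Order.TTheory GRing.Theory Num.Theory.
Import numFieldNormedType.Exports.

Set Implicit Arguments.
Unset Strict Implicit.
Unset Printing Implicit Defensive.

Local Open Scope classical_set_scope.
Local Open Scope ring_scope.
Local Open Scope complex_scope.

(** Estimates and limits use the real form Re <x, y>, so they live in R; the imaginary part is
    recovered by multiplying an argument by i. The absolute value is given only as a chosen positive
    square root of T^* T, so square roots have to be built inside A and shown unique before anything
    is known about p_jk. In place of a polar decomposition, mixed Schwarz is proved for v in the
    range of p and extended to all v by approximation in the seminorm <p u, u>. It is stated as 2
    |<m v, y>| <= t <p v, v> + <p y, y> / t for all t > 0: this form is summed over j and k without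
    square roots, and it passes to the adjoint matrix by exchanging t and 1 / t. The parameter is
    fixed only on use: t = B_r in the estimate of a row, t large in the interchange of sums that
    identifies the adjoint. *)

(** * The real inner product *)

Section RealInnerProduct.
Variables (R : realType) (H : completeNormedModType R[i]).
Implicit Types (x y z : H) (t : R).

Definition rnorm x : R := complex.Re `|x|.

Lemma rnormE x : `|x| = (rnorm x)%:C.
Proof. by rewrite RRe_real // ger0_real. Qed.

Lemma rnorm_ge0 x : 0 <= rnorm x.
Proof. by rewrite -ler0c -rnormE. Qed.

Lemma rnorm_eq0 x : rnorm x = 0 -> x = 0.
Proof. by move=> h; apply/normr0_eq0; rewrite rnormE h. Qed.

Lemma rnorm0 : rnorm 0 = 0.
Proof. by rewrite /rnorm normr0. Qed.

Lemma rnormN x : rnorm (- x) = rnorm x.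
Proof. by rewrite /rnorm normrN. Qed.

Lemma rnormBC x y : rnorm (x - y) = rnorm (y - x).
Proof. by rewrite -rnormN opprB. Qed.

Lemma ler_rnormD x y : rnorm (x + y) <= rnorm x + rnorm y.
Proof. by rewrite -lecR rmorphD /= -!rnormE ler_normD. Qed.

Lemma rnormZ t x : rnorm (t%:C *: x) = `|t| * rnorm x.
Proof.
apply: complexI; rewrite rmorphM /= -!rnormE normrZ; congr (_ * _).
by rewrite normc_def /= expr0n addr0 sqrtr_sqr.
Qed.

Definition vcvg (u : nat -> H) (l : H) := (fun n => rnorm (u n - l)) @ \oo --> (0 : R).

(** Radii of balls in H are elements of R[i], but a positive one has zero imaginary part, so real
    radii suffice. *)
Lemma vcvgP u l : vcvg u l <-> u @ \oo --> l.
Proof.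
split=> h.
  apply/cvgrPdist_le => -[e1 e2]; rewrite ltcE /= => /andP[/eqP -> e0].
  move/cvgrPdist_le: h => /(_ e1 e0); apply: filterS => n.
  by rewrite rnormE lecE /= eqxx /= sub0r normrN ger0_norm ?rnorm_ge0// rnormBC.
apply/cvgrPdist_le => e e0.
move/cvgrPdist_le: h => /(_ e%:C); rewrite ltcR => /(_ e0); apply: filterS => n.
by rewrite rnormE lecR sub0r normrN ger0_norm ?rnorm_ge0// rnormBC.
Qed.

Lemma vcvgE u l : vcvg u l <->
  forall e : R, 0 < e -> exists N, forall n, (N <= n)%N -> rnorm (u n - l) <= e.
Proof.
split=> [/cvgrPdist_le h e e0|h].
  have [N _ hN] := h _ e0; exists N => n Nn.
  by have := hN n Nn; rewrite /= sub0r normrN ger0_norm ?rnorm_ge0.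
apply/cvgrPdist_le => e e0; have [N hN] := h _ e0; exists N => // n Nn.
by rewrite /= sub0r normrN ger0_norm ?rnorm_ge0 ?hN.
Qed.

Lemma vcvg_unique u l1 l2 : vcvg u l1 -> vcvg u l2 -> l1 = l2.
Proof. by move=> /vcvgP h1 /vcvgP h2; apply: (cvg_unique _ h1 h2). Qed.

Lemma vcvg_cauchy u :
  (forall e : R, 0 < e -> exists N, forall n k, (N <= n)%N -> (n <= k)%N ->
     rnorm (u k - u n) <= e) -> exists l, vcvg u l.
Proof.
move=> h; suff /cvg_ex[l hl] : cvg (u @ \oo) by exists l; apply/vcvgP.
apply/cauchy_cvgP/cauchy_exP => -[e1 e2]; rewrite ltcE /= => /andP[/eqP -> e0].
(* Halving turns the large inequality of the hypothesis into the strict one of a ball. *)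
have [N hN] := h _ (divr_gt0 e0 (ltr0n _ 2)); exists (u N); exists N => // n Nn.
rewrite -ball_normE /= rnormE. rewrite rnormBC ltcE /= eqxx /=.
apply: le_lt_trans (hN N n _ _) _ => //.
by rewrite ltr_pdivrMr// ltr_pMr// ltr1n.
Qed.

Lemma vcvg_le u l (c : R) : vcvg u l -> (forall n, rnorm (u n) <= c) -> rnorm l <= c.
Proof.
move=> /vcvgE h hc; apply/ler_addgt0Pr => e e0.
have [N /(_ N (leqnn _)) hN] := h _ e0.
rewrite -(subrK (u N) l) addrC; apply: le_trans (ler_rnormD _ _) _.
by rewrite lerD// rnormBC.
Qed.

Lemma vcvgD u v l k : vcvg u l -> vcvg v k -> vcvg (fun n => u n + v n) (l + k).
Proof. by move=> /vcvgP hu /vcvgP hv; apply/vcvgP; apply: cvgD. Qed.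

Lemma vcvgZ (c : R[i]) u l : vcvg u l -> vcvg (fun n => c *: u n) (c *: l).
Proof. by move=> /vcvgP hu; apply/vcvgP; apply: cvgZr. Qed.

Variable dot : {dot H for Num.conj}.

Definition rdot x y : R := complex.Re (dot x y).

Lemma ReN (z : R[i]) : complex.Re (- z) = - complex.Re z.
Proof. by case: z. Qed.

Lemma ReD (z w : R[i]) : complex.Re (z + w) = complex.Re z + complex.Re w.
Proof. by case: z; case: w. Qed.

Lemma dotC x y : dot y x = conjc (dot x y).
Proof. by rewrite hermC /= expr0 mul1r. Qed.

Lemma rdotC x y : rdot x y = rdot y x.
Proof. by rewrite /rdot (dotC y x); case: (dot y x). Qed.

Lemma rdotDl x y z : rdot (x + y) z = rdot x z + rdot y z.
Proof. by rewrite /rdot linearDl ReD. Qed.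

Lemma rdotDr x y z : rdot x (y + z) = rdot x y + rdot x z.
Proof. by rewrite rdotC rdotDl !(rdotC x). Qed.

Lemma rdotNl x y : rdot (- x) y = - rdot x y.
Proof. by rewrite /rdot linearNl ReN. Qed.

Lemma rdotNr x y : rdot x (- y) = - rdot x y.
Proof. by rewrite rdotC rdotNl rdotC. Qed.

Lemma rdotZl t x y : rdot (t%:C *: x) y = t * rdot x y.
Proof.
by rewrite /rdot linearZl_LR /=; case: (dot x y) => a b /=; rewrite mul0r subr0.
Qed.

Lemma rdotZr t x y : rdot x (t%:C *: y) = t * rdot x y.
Proof. by rewrite rdotC rdotZl rdotC. Qed.

Lemma rdot0l y : rdot 0 y = 0.
Proof. by rewrite /rdot linear0l. Qed.

Lemma rdot_suml (I : Type) (s : seq I) (P : pred I) (u : I -> H) y :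
  rdot (\sum_(i <- s | P i) u i) y = \sum_(i <- s | P i) rdot (u i) y.
Proof.
by apply: (big_morph (fun x => rdot x y)) => [a b|]; rewrite ?rdotDl ?rdot0l.
Qed.

Definition rdotE := (rdotDl, rdotDr, rdotNl, rdotNr, rdotZl, rdotZr).

Lemma rdot_il x y : rdot ('i *: x) y = - rdot x ('i *: y).
Proof.
rewrite /rdot linearZl_LR linearZr_LR /=; case: (dot x y) => a b /=.
by ring.
Qed.

Lemma Im_dot x y : complex.Im (dot x y) = - rdot ('i *: x) y.
Proof.
by rewrite /rdot linearZl_LR /=; case: (dot x y) => a b /=; rewrite mul0r mul1r sub0r opprK.
Qed.

Hypothesis dotE : forall x : H, dot x x = `|x| ^+ 2.

Lemma rdotxx x : rdot x x = rnorm x ^+ 2.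
Proof. by rewrite /rdot dotE rnormE -rmorphXn. Qed.

Lemma rdot_eq0 x : (forall y, rdot x y = 0) -> x = 0.
Proof.
by move=> /(_ x); rewrite rdotxx => /eqP; rewrite sqrf_eq0 => /eqP /rnorm_eq0.
Qed.

Lemma rdot_inj x y : (forall z, rdot x z = rdot y z) -> x = y.
Proof.
by move=> h; apply/subr0_eq/rdot_eq0 => z; rewrite rdotDl rdotNl h subrr.
Qed.

Lemma rnormD_sqr x y : rnorm (x + y) ^+ 2 = rnorm x ^+ 2 + 2 * rdot x y + rnorm y ^+ 2.
Proof. by rewrite -!rdotxx !rdotE (rdotC y x); ring. Qed.

(** The norm comes with its triangle inequality, so Cauchy-Schwarz is read off from |x + y|^2 <=
    (|x| + |y|)^2. *)
Lemma rdot_le x y : rdot x y <= rnorm x * rnorm y.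
Proof.
have := ler_rnormD x y; rewrite -ler_sqr ?nnegrE ?addr_ge0 ?rnorm_ge0//.
by rewrite rnormD_sqr; set a := rnorm x; set b := rnorm y; lra.
Qed.

Lemma ler_norm_rdot x y : `|rdot x y| <= rnorm x * rnorm y.
Proof. by rewrite ler_norml rdot_le lerNl -rdotNl -(rnormN x) rdot_le. Qed.

Lemma rdot_cvg u l y : vcvg u l -> (fun n => rdot (u n) y) @ \oo --> rdot l y.
Proof.
move=> /vcvgE h; apply/cvgrPdist_le => e e0.
have M0 : 0 < rnorm y + 1 by rewrite ltr_wpDl ?rnorm_ge0.
have [N hN] := h _ (divr_gt0 e0 M0); exists N => // n Nn /=.
rewrite -rdotNl -rdotDl (le_trans (ler_norm_rdot _ _))//.
rewrite rnormBC (le_trans (ler_wpM2r (rnorm_ge0 _) (hN n Nn)))//.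
by rewrite mulrAC ler_pdivrMr// ler_pM2l// lerDl.
Qed.

(** Follows from |u|^2 = |u - l|^2 + 2 <u, l> - |l|^2. *)
Lemma rnorm_cvg u l : vcvg u l -> (fun n => rnorm (u n) ^+ 2) @ \oo --> rnorm l ^+ 2.
Proof.
move=> h.
have h2 : (fun n => 2 * rdot (u n) l - rnorm l ^+ 2) @ \oo -->
    2 * rdot l l - rnorm l ^+ 2.
  apply: cvgB; last exact: cvg_cst.
  by apply: cvgM; [exact: cvg_cst | exact: rdot_cvg].
have := cvgD (cvgM h h) h2; rewrite rdotxx mulr0 add0r.
have -> : 2 * rnorm l ^+ 2 - rnorm l ^+ 2 = rnorm l ^+ 2 by ring.
suff -> : (fun n => rnorm (u n) ^+ 2) = (fun n => rnorm (u n - l)) \*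
    (fun n => rnorm (u n - l)) \+ (fun n => 2 * rdot (u n) l - rnorm l ^+ 2).
  by apply.
apply/funext => n /=.
by rewrite -{1}(subrK l (u n)) rnormD_sqr rdotDl rdotNl !rdotxx; ring.
Qed.

End RealInnerProduct.

(** * Bounded operators and operator series *)

Section LinearMaps.
Variables (K : pzRingType) (V : lmodType K) (T : V -> V).
Hypothesis linT : linear T.

Lemma lin_add x y : T (x + y) = T x + T y.
Proof. by have := linT 1 x y; rewrite !scale1r. Qed.

Lemma lin_zero : T 0 = 0.
Proof. by apply: (addrI (T 0)); rewrite -lin_add !addr0. Qed.

Lemma lin_scale c x : T (c *: x) = c *: T x.
Proof. by have := linT c x 0; rewrite lin_zero !addr0. Qed.

Lemma lin_opp x : T (- x) = - T x.
Proof. by rewrite -scaleN1r lin_scale scaleN1r. Qed.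

Lemma lin_sub x y : T (x - y) = T x - T y.
Proof. by rewrite lin_add lin_opp. Qed.

Lemma lin_sum (I : Type) (s : seq I) (P : pred I) (u : I -> V) :
  T (\sum_(i <- s | P i) u i) = \sum_(i <- s | P i) T (u i).
Proof. by apply: (big_morph T) => [x y|]; rewrite ?lin_add ?lin_zero. Qed.

End LinearMaps.

Section Operators.
Variables (R : realType) (H : completeNormedModType R[i]).
Implicit Types (x y z : H) (t c : R) (S T : H -> H).

Lemma linear_fsum (I : Type) (s : seq I) (P : pred I) (F : I -> H -> H) :
  (forall i, linear (F i)) -> linear (\sum_(i <- s | P i) F i).
Proof.
move=> h c x y; rewrite !fct_sumE scaler_sumr -big_split.
by apply: eq_bigr => i _; rewrite h.
Qed.

Lemma linear_sub S T : linear S -> linear T -> linear (S - T).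
Proof.
move=> hS hT c x y; rewrite /GRing.add /GRing.opp /= hS hT scalerDr scalerN.
by rewrite opprD addrACA.
Qed.

Lemma opnorm_leP T c : linear T -> 0 <= c ->
  (opnorm T <= c%:E)%E <-> forall x, rnorm (T x) <= c * rnorm x.
Proof.
move=> linT c0; split=> [h x|h].
  have [->|x0] := eqVneq x 0; first by rewrite lin_zero// rnorm0 mulr0.
  have n0 : 0 < rnorm x.
    by rewrite lt_def rnorm_ge0 andbT; apply: contra_neq x0 => /rnorm_eq0.
  pose y := (rnorm x)^-1%:C *: x.
  have ny : rnorm y = 1 by rewrite rnormZ gtr0_norm ?invr_gt0// mulVf// gt_eqF.
  have : ((rnorm (T y))%:E <= c%:E)%E.
    apply: le_trans h; apply: ereal_sup_ubound; exists y => //=.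
    by split=> //; rewrite /vnorm -/(rnorm _) ny.
  rewrite lee_fin lin_scale// rnormZ gtr0_norm ?invr_gt0//.
  by rewrite mulrC ler_pdivrMr.
apply: ge_ereal_sup => _ [x [_ x1] <-]; rewrite /vnorm lee_fin.
by apply: le_trans (h x) _; rewrite ler_piMr// -lee_fin.
Qed.

Lemma opnorm_ge0 T : linear T -> (0 <= opnorm T)%E.
Proof.
move=> linT; apply: ereal_sup_ubound; exists 0 => /=.
  by split=> //; rewrite /vnorm lee_fin -/(rnorm _) rnorm0.
by rewrite /vnorm lin_zero// -/(rnorm _) rnorm0.
Qed.

Lemma bounded_opP T : bounded_op T <->
  linear T /\ exists2 c, 0 <= c & forall x, rnorm (T x) <= c * rnorm x.
Proof.
split=> [[linT h]|[linT [c c0 h]]].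
  split=> //; have fT : opnorm T \is a fin_num.
    by rewrite ge0_fin_numE ?opnorm_ge0.
  have c0 : 0 <= fine (opnorm T) by rewrite fine_ge0 ?opnorm_ge0.
  by exists (fine (opnorm T)) => //; apply/opnorm_leP; rewrite ?fineK.
by split=> //; apply: le_lt_trans (ltry c); apply/opnorm_leP.
Qed.

Lemma bounded_linear T : bounded_op T -> linear T. Proof. by case. Qed.

Lemma vcvg_bounded T (u : nat -> H) (l : H) :
  bounded_op T -> vcvg u l -> vcvg (fun n => T (u n)) (T l).
Proof.
move=> /bounded_opP[lT [c c0 hc]] /vcvgE h; apply/vcvgE => e e0.
have c1 : 0 < c + 1 by rewrite ltr_wpDl.
have [N hN] := h _ (divr_gt0 e0 c1); exists N => n Nn.
rewrite -lin_sub//; apply: le_trans (hc _) _.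
apply: le_trans (ler_wpM2l c0 (hN n Nn)) _.
by rewrite mulrCA ler_piMr ?(ltW e0)// ler_pdivrMr// mul1r lerDl.
Qed.

Lemma sot_seriesP (T : nat -> H -> H) S : sot_series T S <->
  bounded_op S /\ forall x, vcvg (fun N => \sum_(n < N) T n x) (S x).
Proof.
have E x : (fun N => (\sum_(n < N) T n) x) = (fun N => \sum_(n < N) T n x).
  by apply/funext => N; rewrite fct_sumE.
rewrite /sot_series pointwise_cvgP; split=> -[bS h]; split=> // x.
  by apply/vcvgP; rewrite -E; exact: (h x).
by have /vcvgP := h x; rewrite -E.
Qed.

(** [get] picks an unspecified element of a nonempty set; uniqueness of pointwise limits forces it
    to be [S]. *)
Lemma sot_sumE (T : nat -> H -> H) S : sot_series T S -> sot_sum T = S.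
Proof.
move=> h; have [_ h1] := (sot_seriesP _ _).1 h.
have [_ h2] := (sot_seriesP _ _).1 (@getPex _ (sot_series T) (ex_intro _ _ h)).
by apply/funext => x; exact: vcvg_unique (h2 x) (h1 x).
Qed.

Lemma norm_seriesP (T : nat -> H -> H) S : (forall n, linear (T n)) ->
  norm_series T S <-> bounded_op S /\ forall e : R, 0 < e ->
    exists N, forall n, (N <= n)%N -> forall x,
      rnorm (\sum_(k < n) T k x - S x) <= e * rnorm x.
Proof.
move=> linT; rewrite /norm_series.
suff E : bounded_op S ->
    ((fun N => opnorm (\sum_(n < N) T n - S)) @ \oo --> (0 : \bar R)%E <->
    forall e : R, 0 < e -> exists N, forall n, (N <= n)%N -> forall x,
      rnorm (\sum_(k < n) T k x - S x) <= e * rnorm x).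
  by split=> -[bS h]; split=> //; apply/(E bS).
move=> bS.
have lin n : linear (\sum_(k < n) T k - S).
  by apply: linear_sub (bounded_linear bS); apply: linear_fsum.
have opE n e : 0 <= e -> (opnorm (\sum_(k < n) T k - S)%R <= e%:E)%E <->
    forall x, rnorm (\sum_(k < n) T k x - S x) <= e * rnorm x.
  by move=> e0; rewrite opnorm_leP//; split=> h x; have := h x; rewrite /GRing.add /= fct_sumE.
have on0 n := opnorm_ge0 (lin n).
split=> [h e e0|h].
  have : nbhs (0 : \bar R)%E [set y | (y < e%:E)%E].
    by apply: open_nbhs_nbhs; split; [exact: open_ereal_lt_ereal|rewrite /= lte_fin].
  move=> /h[N _ hN]; exists N => n Nn; apply/opE; first exact: ltW.
  exact/ltW/hN.
(* Convergence in the extended reals splits into eventual finiteness, obtained with e = 1, and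
   convergence in R. *)
apply/fine_cvgP; split.
  have [N hN] := h _ ltr01; exists N => // n Nn /=.
  rewrite ge0_fin_numE ?on0//. apply: le_lt_trans (ltry (1 : R)).
  by apply/opE => //; exact: hN.
apply/cvgrPdist_le => e e0; have [N hN] := h _ e0; exists N => // n Nn /=.
have le := (opE n e (ltW e0)).2 (hN n Nn).
rewrite sub0r normrN ger0_norm ?fine_ge0 ?on0//.
rewrite -lee_fin fineK// ge0_fin_numE ?on0//.
exact: le_lt_trans le (ltry e).
Qed.

Lemma norm_sot_series (T : nat -> H -> H) S : (forall n, linear (T n)) ->
  norm_series T S -> sot_series T S.
Proof.
move=> linT /norm_seriesP-/(_ linT)[bS h]; apply/sot_seriesP; split=> // x.
apply/vcvgE => e e0; have x1 : 0 < rnorm x + 1 by rewrite ltr_wpDl ?rnorm_ge0.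
have [N hN] := h _ (divr_gt0 e0 x1); exists N => n Nn.
apply: le_trans (hN _ Nn x) _.
by rewrite mulrAC ler_pdivrMr// ler_pM2l// lerDl.
Qed.

(** Norm limits are strong limits, so uniqueness is inherited from the strong topology. *)
Lemma norm_sumE (T : nat -> H -> H) S : (forall n, linear (T n)) ->
  norm_series T S -> norm_sum T = S.
Proof.
move=> linT h; have h1 := norm_sot_series linT h.
have := @getPex _ (norm_series T) (ex_intro _ _ h) => /(norm_sot_series linT) h2.
by rewrite -(sot_sumE h1) (sot_sumE h2).
Qed.

Variable dot : {dot H for Num.conj}.
Hypothesis dotE : forall x : H, dot x x = `|x| ^+ 2.

Lemma adjointE S T : is_adjoint dot T S -> adjoint dot T = S.
Proof.
move=> h; have [_ h1] := h.
have [_ h2] := @getPex _ (is_adjoint dot T) (ex_intro _ _ h).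
apply/funext => y; apply: (rdot_inj dotE) => x.
by rewrite !(rdotC _ _ x) /rdot -h1 -h2.
Qed.

Definition selfadj T := forall x y, rdot dot (T x) y = rdot dot x (T y).

(* The parabola t |-> <P (x - t P x), x - t P x> is nonnegative at t = 1 / c. *)
Lemma positive_norm_le T c : linear T -> selfadj T -> 0 <= c ->
  (forall x, 0 <= rdot dot (T x) x <= c * rnorm x ^+ 2) ->
  forall x, rnorm (T x) ^+ 2 <= c * rdot dot (T x) x.
Proof.
move=> linT sT c0 h x.
have key t : 0 <= rdot dot (T x) x - 2 * t * rnorm (T x) ^+ 2
    + t ^+ 2 * (c * rnorm (T x) ^+ 2).
  have /andP[h1 _] := h (x - t%:C *: T x).
  have /andP[_ h2] := h (T x); apply: le_trans h1 _.
  rewrite lin_sub// lin_scale// !(rdotE, rdotDr, rdotNr, rdotZr) (sT (T x) x).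
  rewrite (rdotxx dotE) -subr_ge0.
  set a := rdot _ (T x) x; set b := rnorm _ ^+ 2; set d := rdot _ _ _.
  rewrite [X in 0 <= X](_ : _ = t ^+ 2 * (c * b - d)); last by ring.
  by rewrite mulr_ge0 ?sqr_ge0// subr_ge0.
have := key c^-1; have /andP[h1 h2] := h x.
(* At c = 0 the point 1 / c is meaningless, but the form vanishes and t = 1 already forces T x =
   0. *)
have [c_eq0|cn0] := eqVneq c 0.
  by have := key 1; move: h1 h2; rewrite c_eq0; lra.
have cp : 0 < c by rewrite lt_def cn0.
set a := rdot _ _ _; set b := rnorm _ ^+ 2 => h3.
have -> : b = c * a - c * (a - 2 * c^-1 * b + c^-1 ^+ 2 * (c * b)) by field.
by rewrite gerBl mulr_ge0.
Qed.

Lemma positive_bound T c : linear T -> selfadj T -> 0 <= c ->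
  (forall x, 0 <= rdot dot (T x) x <= c * rnorm x ^+ 2) ->
  forall x, rnorm (T x) <= c * rnorm x.
Proof.
move=> linT sT c0 h x; rewrite -ler_sqr ?nnegrE ?mulr_ge0 ?rnorm_ge0//.
apply: le_trans (positive_norm_le linT sT c0 h x) _.
by rewrite exprMn expr2 -mulrA ler_wpM2l//; have /andP[] := h x.
Qed.

(** As <T x, x> is real, Re <T (i x), x> = 0 for all x. Polarizing makes (x, y) |-> Re <T (i x), y>
    antisymmetric, and substituting x = i w turns this into symmetry of T. *)
Lemma positive_selfadj T : positive_op dot T -> selfadj T.
Proof.
move=> [[linT _] pT]; have im x : rdot dot (T ('i *: x)) x = 0.
  by rewrite lin_scale// -[LHS]opprK -Im_dot (ger0_Im (pT x)) oppr0.
have im2 x y : rdot dot (T ('i *: x)) y = - rdot dot (T ('i *: y)) x.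
  have := im (x + y); rewrite scalerDr lin_add// !(rdotE, rdotDr) !im.
  by lra.
move=> x y; pose w := - 'i *: x; have xE : x = 'i *: w.
  by rewrite scalerA mulrN -expr2 sqr_i opprK scale1r.
by rewrite [in LHS]xE im2 lin_scale// rdot_il opprK -xE rdotC.
Qed.

(** Complex positivity also asks that Im <T x, x> be 0: up to sign this is Re <i T x, x>, which
    self-adjointness equates with its own negative. *)
Lemma selfadj_positive T : bounded_op T -> selfadj T ->
  (forall x, 0 <= rdot dot (T x) x) -> positive_op dot T.
Proof.
move=> bT sT h; split=> // x; rewrite lecE /= h andbT; have [linT _] := bT.
rewrite Im_dot oppr_eq0; apply/eqP.
have : rdot dot ('i *: T x) x = - rdot dot ('i *: T x) x.
  by rewrite -[in LHS](lin_scale linT) sT rdot_il opprK rdotC.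
by lra.
Qed.

End Operators.

(** * Square roots in a von Neumann algebra *)

Section Limits.
Variables (R : realType) (H : completeNormedModType R[i]).

Lemma vcvg_cst (l : H) : vcvg (fun=> l) l.
Proof. by apply/vcvgP; exact: cvg_cst. Qed.

Lemma vcvg_ext (u v : nat -> H) l : (forall n, u n = v n) -> vcvg u l -> vcvg v l.
Proof. by move=> /funext ->. Qed.

Lemma vcvg_shift (u : nat -> H) l : vcvg u l -> vcvg (fun n => u n.+1) l.
Proof.
move=> /vcvgE h; apply/vcvgE => e e0; have [N hN] := h e e0.
by exists N => n Nn; apply: hN; exact: leqW.
Qed.

Lemma pointwise_limit (T : nat -> H -> H) (c : R) : (forall n, linear (T n)) ->
  0 <= c -> (forall n x, rnorm (T n x) <= c * rnorm x) ->
  (forall x, exists l, vcvg (fun n => T n x) l) ->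
  exists S, [/\ bounded_op S, forall x, vcvg (fun n => T n x) (S x) &
    forall x, rnorm (S x) <= c * rnorm x].
Proof.
move=> linT c0 hc /choice[S hS].
have lS : linear S.
  move=> a x y; apply: (vcvg_unique (hS _)).
  by apply: (vcvg_ext _ (vcvgD (vcvgZ a (hS x)) (hS y))) => n; rewrite linT.
have bS x : rnorm (S x) <= c * rnorm x by apply: (vcvg_le (hS x)).
by exists S; split=> //; apply/bounded_opP; split=> //; exists c.
Qed.

End Limits.

(** * Stability properties, normality, square roots and absolute values in A *)

Section VonNeumann.
Variables (R : realType) (H : completeNormedModType R[i]).
Variable dot : {dot H for Num.conj}.
Hypothesis dotE : forall x : H, dot x x = `|x| ^+ 2.
Variable A : set (H -> H).
Hypotheses (vnA : von_neumann_algebra dot A) (comA : commutative_algebra A).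
Implicit Types (S T : H -> H) (x y z : H).

Local Notation rdt := (rdot dot).

Lemma vn_blinear T : A T -> linear T.
Proof. by move=> /(vn_bounded vnA)/bounded_linear. Qed.

Lemma vn_zero : A (0 : H -> H).
Proof.
have := vn_linear vnA (-1) (vn_id vnA) (vn_id vnA).
by rewrite scaleN1r addNr.
Qed.

Lemma vn_add S T : A S -> A T -> A (S + T).
Proof. by move=> hS hT; have := vn_linear vnA 1 hS hT; rewrite scale1r. Qed.

Lemma vn_scale (c : R[i]) S : A S -> A (c *: S).
Proof. by move=> hS; have := vn_linear vnA c hS vn_zero; rewrite addr0. Qed.

Lemma vn_opp S : A S -> A (- S).
Proof. by rewrite -scaleN1r; apply: vn_scale. Qed.

Lemma vn_sum (I : Type) (s : seq I) (F : I -> H -> H) :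
  (forall i, A (F i)) -> A (\sum_(i <- s) F i).
Proof.
move=> h; elim: s => [|i s IH]; first by rewrite big_nil; apply: vn_zero.
by rewrite big_cons; apply: vn_add.
Qed.

Lemma vn_limit (T : nat -> H -> H) S : (forall n, A (T n)) -> bounded_op S ->
  (forall x, vcvg (fun n => T n x) (S x)) -> A S.
Proof.
move=> hT bS h; apply: (vn_closed vnA) => // B hB.
have /(_ B hB)[N _ hN] : {ptws, T @ \oo --> S}.
  by apply/pointwise_cvgP => x; apply/vcvgP/h.
by exists (T N); split=> //; apply: hN => /=.
Qed.

Lemma vn_comm S T : A S -> A T -> forall x, S (T x) = T (S x).
Proof. by move=> hS hT x; have /(congr1 (@^~ x)) := comA hS hT. Qed.

Lemma vn_adjointP T : A T -> A (adjoint dot T) /\ is_adjoint dot T (adjoint dot T).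
Proof. by move=> /(vn_adjoint vnA)[S hS h]; rewrite (adjointE dotE h). Qed.

Lemma vn_adj T : A T -> A (adjoint dot T).
Proof. by case/vn_adjointP. Qed.

Lemma vn_rdotr T : A T -> forall x y, rdt (T x) y = rdt x (adjoint dot T y).
Proof. by move=> /vn_adjointP[_ [_ h]] x y; rewrite /rdot h. Qed.

Lemma vn_rdotl T : A T -> forall x y, rdt (adjoint dot T x) y = rdt x (T y).
Proof. by move=> hT x y; rewrite rdotC -[LHS](vn_rdotr hT) rdotC. Qed.

(** Normality: commutativity of A makes T commute with its adjoint, and both squared norms are
    values of the same quadratic form. *)
Lemma vn_adj_norm T : A T -> forall x, rnorm (adjoint dot T x) = rnorm (T x).
Proof.
move=> hT x; apply/eqP; rewrite -(@eqrXn2 _ 2) ?rnorm_ge0// -!(rdotxx dotE); apply/eqP.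
rewrite -[RHS](vn_rdotl hT) -[LHS](vn_rdotr hT).
by rewrite (vn_comm hT)//; exact: vn_adj.
Qed.

Section SquareRootIteration.
Variable B : H -> H.
Hypotheses (AB : A B) (sB : selfadj dot B) (B1 : forall x, rnorm (B x) <= rnorm x).

(* The limit is 1 - sqrt (1 - B).  The scalar sequence [sqrt_bound], obtained by
   putting 1 for B, controls both |Y_n| and |Y_(n+1) - Y_n|. *)
Fixpoint sqrt_iter n : H -> H :=
  if n is n'.+1 then (2^-1)%:C *: (B + (sqrt_iter n' \o sqrt_iter n')) else 0.

Fixpoint sqrt_bound n : R :=
  if n is n'.+1 then 2^-1 * (1 + sqrt_bound n' ^+ 2) else 0.

Local Notation Y := sqrt_iter.
Local Notation b := sqrt_bound.

Lemma sqrt_iterS n x : Y n.+1 x = (2^-1)%:C *: (B x + Y n (Y n x)).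
Proof. by []. Qed.

Lemma sqrt_iter_vn n : A (Y n).
Proof.
elim: n => [|n IH] /=; first exact: vn_zero.
by apply: vn_scale; apply: vn_add => //; apply: (vn_comp vnA).
Qed.

Lemma sqrt_bound_ge0 n : 0 <= b n.
Proof. by case: n => //= n; rewrite mulr_ge0 ?invr_ge0// addr_ge0 ?sqr_ge0. Qed.

Lemma sqrt_bound_le1 n : b n <= 1.
Proof. by elim: n => //= n IH; have := sqrt_bound_ge0 n; nra. Qed.

Lemma sqrt_bound_incr n : b n <= b n.+1.
Proof.
elim: n => [|n IH] /=; first by lra.
by move: IH => /= IH; have := sqrt_bound_ge0 n; nra.
Qed.

Lemma sqrt_iter_norm n x : rnorm (Y n x) <= b n * rnorm x.
Proof.
elim: n x => [|n IH] x /=; first by rewrite rnorm0 mul0r.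
rewrite rnormZ gtr0_norm ?invr_gt0// -mulrA ler_wpM2l ?invr_ge0//.
apply: le_trans (ler_rnormD _ _) _; rewrite mulrDl mul1r lerD//.
apply: le_trans (IH _) _; rewrite expr2 -mulrA.
by rewrite ler_wpM2l ?sqrt_bound_ge0.
Qed.

(** Twice the next difference is Y_(n+1)^2 - Y_n^2 = Y_(n+1) (Y_(n+1) - Y_n) + (Y_(n+1) - Y_n) Y_n.
    Bounding the factors reproduces the recursion that the increments of b satisfy with equality. *)
Lemma sqrt_iter_diff n x : rnorm (Y n.+1 x - Y n x) <= (b n.+1 - b n) * rnorm x.
Proof.
elim: n x => [|n IH] x.
  have := sqrt_iter_norm 1 x.
  by rewrite /= !subr0.
have lin k := vn_blinear (sqrt_iter_vn k).
have -> : Y n.+2 x - Y n.+1 x =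
    (2^-1)%:C *: (Y n.+1 (Y n.+1 x - Y n x) + (Y n.+1 (Y n x) - Y n (Y n x))).
  rewrite {1}sqrt_iterS [X in _ - X = _]sqrt_iterS -scalerBr (lin_sub (lin n.+1)).
  by congr (_ *: _); rewrite opprD addrACA subrr add0r addrA subrK.
rewrite rnormZ gtr0_norm ?invr_gt0//.
have -> : (b n.+2 - b n.+1) = 2^-1 * ((b n.+1 + b n) * (b n.+1 - b n)).
  have bS k : b k.+1 = 2^-1 * (1 + b k ^+ 2) by [].
  by rewrite (bS n.+1); have := bS n; move: (b n.+1) (b n) => p q; lra.
rewrite -mulrA ler_wpM2l ?invr_ge0//; apply: le_trans (ler_rnormD _ _) _.
rewrite mulrDl mulrDl lerD//.
  apply: le_trans (sqrt_iter_norm _ _) _.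
  by rewrite -mulrA ler_wpM2l ?sqrt_bound_ge0.
apply: le_trans (IH _) _.
rewrite mulrAC mulrC ler_wpM2r ?subr_ge0 ?sqrt_bound_incr//.
exact: sqrt_iter_norm.
Qed.

Lemma sqrt_iter_cauchy n k x : (n <= k)%N ->
  rnorm (Y k x - Y n x) <= (b k - b n) * rnorm x.
Proof.
move=> /subnK <-; elim: (k - n)%N => [|d IH].
  by rewrite add0n !subrr rnorm0 mul0r.
rewrite addSn; set j := (d + n)%N in IH *.
have -> : Y j.+1 x - Y n x = (Y j.+1 x - Y j x) + (Y j x - Y n x).
  by rewrite addrA subrK.
have -> : b j.+1 - b n = (b j.+1 - b j) + (b j - b n) by rewrite addrA subrK.
by apply: le_trans (ler_rnormD _ _) _; rewrite mulrDl lerD ?sqrt_iter_diff.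
Qed.

(** Since |B| = 1 is allowed, the steps need not shrink geometrically; their sum is controlled
    because b is nondecreasing and bounded by 1. *)
Lemma sqrt_iter_cvg x : exists l, vcvg (fun n => Y n x) l.
Proof.
have incr : {homo b : n m / (n <= m)%N >-> n <= m}.
  by apply: homo_leq => //; [exact: le_trans | exact: sqrt_bound_incr].
have cb : cvgn b.
  apply: nondecreasing_is_cvgn => //.
  by exists 1 => _ [n _ <-]; exact: sqrt_bound_le1.
apply: vcvg_cauchy => e e0.
have x1 : 0 < rnorm x + 1 by rewrite ltr_wpDl ?rnorm_ge0.
have /cvgrPdist_le/(_ _ (divr_gt0 e0 x1))[N _ hN] := cb.
exists N => n k Nn nk; apply: le_trans (sqrt_iter_cauchy x nk) _.
have bk : b k <= limn b by apply: nondecreasing_cvgn_le.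
have := le_trans (ler_norm _) (hN n Nn).
rewrite ler_pdivlMr// => h; apply: le_trans h.
have kn := incr _ _ nk.
by rewrite ler_pM ?rnorm_ge0 ?subr_ge0 ?lerD2r ?lerDl.
Qed.

Lemma sqrt_iter_selfadj n : selfadj dot (Y n).
Proof.
elim: n => [|n IH] x y /=.
  by rewrite rdot0l rdotC rdot0l.
by rewrite rdotZl rdotZr rdotDl rdotDr sB !IH.
Qed.

Lemma sqrt_iter_limit : exists S, [/\ A S, selfadj dot S,
  forall x, rnorm (S x) <= rnorm x,
  forall x, S x = (2^-1)%:C *: (B x + S (S x)) &
  forall Z, bounded_op Z -> (forall x, Z (B x) = B (Z x)) ->
    forall x, Z (S x) = S (Z x)].
Proof.
have lin k := vn_blinear (sqrt_iter_vn k).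
have n1 n x : rnorm (Y n x) <= 1 * rnorm x.
  by apply: le_trans (sqrt_iter_norm _ _) _; rewrite ler_wpM2r ?rnorm_ge0 ?sqrt_bound_le1.
have [S [bS hS nS]] := pointwise_limit lin ler01 n1 sqrt_iter_cvg.
have lS := bounded_linear bS.
exists S; split.
- exact: vn_limit sqrt_iter_vn bS hS.
- move=> x y; have h1 := rdot_cvg (y := y) dotE (hS x).
  have h2 := rdot_cvg (y := x) dotE (hS y); rewrite (rdotC _ x).
  have E : (fun n => rdot dot (Y n x) y) = (fun n => rdot dot (Y n y) x).
    by apply/funext => n; rewrite sqrt_iter_selfadj rdotC.
  by rewrite E in h1; apply: (cvg_unique _ h1 h2).
- by move=> x; rewrite -[leRHS]mul1r.
- move=> x; apply: (vcvg_unique (vcvg_shift (hS x))).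
  apply/(vcvg_ext (fun n => esym (sqrt_iterS n x)))/vcvgZ/vcvgD; first exact: vcvg_cst.
  (* The uniform bound |Y_n| <= 1 makes the product of strong limits converge: Y_n Y_n x tends to S
     S x. *)
  have h0 : vcvg (fun n => Y n (Y n x - S x)) 0.
    apply/vcvgE => e e0; have [N hN] := (vcvgE _ _).1 (hS x) e e0.
    exists N => n Nn; rewrite subr0; apply: le_trans (n1 _ _) _.
    by rewrite mul1r hN.
  have := vcvgD h0 (hS (S x)); rewrite add0r.
  by apply: vcvg_ext => n; rewrite (lin_sub (lin n)) subrK.
- move=> Z bZ hZ x; have lZ := bounded_linear bZ.
  (* Every iterate is a polynomial in B, so Z commutes with it. *)
  have hY n y : Z (Y n y) = Y n (Z y).
    elim: n y => [|n IH] y; first by rewrite /= lin_zero.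
    by rewrite !sqrt_iterS (lin_scale lZ) (lin_add lZ) hZ !IH.
  apply: (vcvg_unique (vcvg_bounded bZ (hS x))).
  by apply: (vcvg_ext _ (hS (Z x))) => n; rewrite hY.
Qed.

End SquareRootIteration.

(** For c bounding T, B = 1 - T / c is a self-adjoint contraction and sqrt c (1 - Y) is the root.
    The last clause ranges over all bounded Z, not just Z in A, because it will be applied to
    another square root of T that is not yet known to lie in A. *)
Lemma vn_sqrt T : A T -> positive_op dot T -> exists S, [/\ A S,
  positive_op dot S, S \o S = T &
  forall Z, bounded_op Z -> (forall x, Z (T x) = T (Z x)) ->
    forall x, Z (S x) = S (Z x)].
Proof.
move=> AT pT; have sT := positive_selfadj pT.
have /bounded_opP[lT [c0 c00 hc0]] := vn_bounded vnA AT.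
pose c := c0 + 1; have cp : 0 < c by rewrite ltr_wpDl.
have hc x : rdt (T x) x <= c * rnorm x ^+ 2.
  apply: le_trans (rdot_le dotE _ _) _; rewrite expr2 mulrA.
  rewrite ler_wpM2r ?rnorm_ge0//; apply: le_trans (hc0 x) _.
  by rewrite ler_wpM2r ?rnorm_ge0// lerDl.
have hp x : 0 <= rdt (T x) x by have := pT.2 x; rewrite lecE => /andP[].
pose B : H -> H := id - (c^-1)%:C *: T.
have BE x : B x = x - (c^-1)%:C *: T x by [].
have AB : A B by apply: vn_add; [exact: vn_id vnA | apply/vn_opp/vn_scale].
have sB : selfadj dot B.
  by move=> x y; rewrite !BE !(rdotE, rdotDr, rdotNr, rdotZr) sT.
have B1 x : rnorm (B x) <= rnorm x.
  rewrite -[leRHS]mul1r; apply: (positive_bound dotE (vn_blinear AB)) => // {}x.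
  rewrite BE !(rdotE) (rdotxx dotE) mul1r gerBl subr_ge0 ler_pdivrMl//.
  by rewrite hc mulr_ge0 ?invr_ge0 ?hp// ltW.
have [Y [AY sY Y1 YE comY]] := sqrt_iter_limit AB sB B1.
have lY := vn_blinear AY.
pose S : H -> H := (Num.sqrt c)%:C *: (id - Y).
have SE x : S x = (Num.sqrt c)%:C *: (x - Y x) by [].
have AS : A S by apply/vn_scale/vn_add; [exact: vn_id vnA | exact: vn_opp].
exists S; split=> //.
- apply: (selfadj_positive (vn_bounded vnA AS)) => [x y|x].
    by rewrite !SE !(rdotE, rdotDr, rdotNr, rdotZr) sY.
  rewrite SE !rdotE (rdotxx dotE) mulr_ge0 ?sqrtr_ge0// subr_ge0 expr2.
  by apply: le_trans (rdot_le dotE _ _) _; rewrite ler_wpM2r ?rnorm_ge0.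
- apply/funext => x /=; rewrite !SE (lin_scale lY) -scalerBr scalerA -rmorphM/=.
  rewrite -expr2 sqr_sqrtr ?ltW// (lin_sub lY) opprB.
  (* The fixed point equation 2 Y = B + Y^2, that is (1 - Y)^2 = 1 - B = T / c. *)
  have h2 : Y x + Y x = B x + Y (Y x).
    set w := B x + _; have -> : Y x = (2^-1)%:C *: w by exact: YE.
    rewrite -scalerDl -rmorphD /=; have -> : 2^-1 + 2^-1 = 1 :> R by lra.
    by rewrite scale1r.
  rewrite addrA addrAC -[x - Y x - Y x]addrA -opprD h2 opprD addrA subrK BE.
  rewrite opprB addrCA subrr addr0 scalerA -rmorphM/= mulfV ?gt_eqF// scale1r.
  by [].
- move=> Z bZ hZ x; have lZ := bounded_linear bZ.
  rewrite !SE (lin_scale lZ) (lin_sub lZ) comY// => y.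
  by rewrite !BE (lin_sub lZ) (lin_scale lZ) hZ.
Qed.

(* w = P v - S v satisfies (P + S) w = P^2 v - S^2 v = 0, so <P w, w> = <S w, w> = 0,
   whence P w = S w = 0 and |w|^2 = <v, (P - S) w> = 0. *)
Lemma positive_sqrt_unique S P T : positive_op dot S ->
  positive_op dot P -> S \o S = T -> P \o P = T ->
  (forall x, P (S x) = S (P x)) -> P = S.
Proof.
move=> pS pP hS hP com.
have sS := positive_selfadj pS; have sP := positive_selfadj pP.
have [[bS _] _] := pS; have [[bP _] _] := pP.
have ge (Q : H -> H) x : positive_op dot Q -> 0 <= rdt (Q x) x.
  by case=> _ /(_ x); rewrite lecE => /andP[].
have zero (Q : H -> H) x : positive_op dot Q -> rdt (Q x) x = 0 -> Q x = 0.
  move=> pQ h0; have /bounded_opP[lQ [c c0 hc]] := pQ.1.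
  apply: rnorm_eq0; apply/eqP; rewrite -sqrf_eq0 eq_le sqr_ge0 andbT.
  have := positive_norm_le dotE lQ (positive_selfadj pQ) c0 _ x.
  rewrite h0 mulr0; apply => y; rewrite ge//= expr2 mulrA.
  apply: le_trans (rdot_le dotE _ _) _.
  by rewrite ler_wpM2r ?rnorm_ge0.
apply/funext => v; apply/subr0_eq; set w := P v - S v.
have hw : P w + S w = 0.
  rewrite /w (lin_sub bP) (lin_sub bS) com addrA subrK.
  by have := congr1 (@^~ v) hS; have := congr1 (@^~ v) hP => /= -> ->; rewrite subrr.
have h0 : rdt (P w) w + rdt (S w) w = 0 by rewrite -rdotDl hw rdot0l.
have h1 := ge P w pP; have h2 := ge S w pS.
have Pw : P w = 0 by apply: zero => //; lra.
have Sw : S w = 0 by apply: zero => //; lra.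
apply: rnorm_eq0; apply/eqP; rewrite -sqrf_eq0 -(rdotxx dotE); apply/eqP.
by rewrite {1}/w rdotDl rdotNl sP sS Pw Sw !(rdotC _ v) rdot0l subrr.
Qed.

(** The operator P chosen by [get] commutes with P^2 = T^* T, hence with the constructed root S, and
    uniqueness gives P = S. Then |S x|^2 = <S^2 x, x> = <T^* T x, x> = |T x|^2. *)
Lemma abs_opP T : A T -> [/\ A (abs_op dot T), positive_op dot (abs_op dot T) &
  forall x, rnorm (abs_op dot T x) = rnorm (T x)].
Proof.
move=> AT; have AT' := vn_adj AT; have ATT := vn_comp vnA AT' AT.
have pTT : positive_op dot (adjoint dot T \o T).
  apply: (selfadj_positive (vn_bounded vnA ATT)) => [x y|x] /=.
    by rewrite [LHS](vn_rdotl AT) [LHS](vn_rdotr AT).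
  by rewrite [leRHS](vn_rdotl AT) (rdotxx dotE) sqr_ge0.
have [S [AS pS hS com]] := vn_sqrt ATT pTT.
have [pP hP] : positive_op dot (abs_op dot T) /\
    abs_op dot T \o abs_op dot T = adjoint dot T \o T.
  by apply: (@getPex _ [set S | positive_op dot S /\ S \o S = _]); exists S.
have eP : abs_op dot T = S.
  apply: (positive_sqrt_unique pS pP hS hP).
  apply: com => [|x]; first by case: pP.
  by have := congr1 (@^~ (abs_op dot T x)) hP; have := congr1 (abs_op dot T \o @^~ x) hP => /= <- ->.
rewrite eP; split=> // x; apply/eqP; rewrite -(@eqrXn2 _ 2) ?rnorm_ge0//.
rewrite -!(rdotxx dotE) -(positive_selfadj pS) -[eqbRHS](vn_rdotl AT).
by have /= -> := congr1 (@^~ x) hS.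
Qed.

End VonNeumann.

(** * The mixed Schwarz inequality and dominated series *)

Section MixedSchwarz.
Variables (R : realType) (H : completeNormedModType R[i]).
Variable dot : {dot H for Num.conj}.
Hypothesis dotE : forall x : H, dot x x = `|x| ^+ 2.
Implicit Types (S T : H -> H) (x y z : H).

Local Notation rdt := (rdot dot).

(* Steepest descent for <p u, u>, starting from v: each step u |-> u - p u / c
   lowers |u|^2 by at least <p u, u> / c. *)
Lemma positive_approx (p : H -> H) (c : R) v : linear p -> 0 < c ->
  (forall x, 0 <= rdt (p x) x) ->
  (forall x, rnorm (p x) ^+ 2 <= c * rdt (p x) x) ->
  forall d : R, 0 < d -> exists w, rdt (p (v - p w)) (v - p w) <= d.
Proof.
move=> lp cp p0 pc d dp.
pose u n := iter n (fun z => z - (c^-1)%:C *: p z) v.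
have uE n : exists w, u n = v - p w.
  elim: n => [|n [w IH]]; first by exists 0; rewrite lin_zero// subr0.
  exists (w + (c^-1)%:C *: u n).
  by rewrite (lin_add lp) (lin_scale lp) opprD addrA -IH.
suff [n hn] : exists n, rdt (p (u n)) (u n) <= d.
  by have [w uw] := uE n; exists w; rewrite -uw.
apply: contrapT => /forallNP h.
have dec n : rnorm (u n) ^+ 2 <= rnorm v ^+ 2 - n%:R * (c^-1 * d).
  elim: n => [|n IH]; first by rewrite mul0r subr0.
  have /negP := h n; rewrite -ltNge => /ltW hn.
  rewrite (_ : u n.+1 = u n + (- c^-1)%:C *: p (u n)); last first.
    by rewrite rmorphN scaleNr.
  rewrite (rnormD_sqr dotE) rdotZr rdotC rnormZ exprMn normrN real_normK ?num_real//.
  have h1 : c^-1 ^+ 2 * rnorm (p (u n)) ^+ 2 <= c^-1 * rdt (p (u n)) (u n).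
    rewrite expr2 -mulrA; apply: ler_wpM2l; first by rewrite invr_ge0 ltW.
    by rewrite mulrC ler_pdivrMr// mulrC.
  have h2 : c^-1 * d <= c^-1 * rdt (p (u n)) (u n).
    by apply: ler_wpM2l hn; rewrite invr_ge0 ltW.
  rewrite -natr1 mulrDl mul1r; move: h1 h2 IH.
  set s := rdt _ _; set P := rnorm (p _) ^+ 2.
  by lra.
have s0 : 0 < c^-1 * d by rewrite mulr_gt0 ?invr_gt0.
have [n0 hn0] : exists n : nat, rnorm v ^+ 2 < n%:R * (c^-1 * d).
  exists (Num.bound (rnorm v ^+ 2 / (c^-1 * d))).
  rewrite -ltr_pdivrMr//; apply: archi_boundP.
  by rewrite divr_ge0 ?sqr_ge0// ltW.
have := dec n0; have := sqr_ge0 (rnorm (u n0)); lra.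
Qed.

(* For v = p w this is Cauchy-Schwarz for the form <p ., .>, as m p w = p m w
   and <p m w, m w> = <p (p w), p w>. *)
Lemma mixed_schwarz (m p : H -> H) : linear m -> positive_op dot p ->
  (forall x, m (p x) = p (m x)) -> (forall x, rnorm (p x) = rnorm (m x)) ->
  forall (t : R) v y, 0 < t ->
  2 * `|rdt (m v) y| <= t * rdt (p v) v + t^-1 * rdt (p y) y.
Proof.
move=> lm pp com np t v y t0.
wlog h0 : v / 0 <= rdt (m v) y.
  move=> W; have [|/ltW] := leP 0 (rdt (m v) y); first exact: W.
  have /bounded_opP[lp _] := pp.1 => h; have := W (- v).
  rewrite !(lin_opp lm) (lin_opp lp) !(rdotNl, rdotNr) opprK normrN.
  by apply; rewrite oppr_ge0.
rewrite ger0_norm// => {h0}.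
have sp := positive_selfadj pp.
have /bounded_opP[lp [c0 c00 hc0]] := pp.1.
have p0 x : 0 <= rdt (p x) x by have := pp.2 x; rewrite lecE => /andP[].
pose c := c0 + 1; have cp : 0 < c by rewrite ltr_wpDl.
have hc x : rdt (p x) x <= c * rnorm x ^+ 2.
  apply: le_trans (rdot_le dotE _ _) _; rewrite expr2 mulrA.
  rewrite ler_wpM2r ?rnorm_ge0//; apply: le_trans (hc0 x) _.
  by rewrite ler_wpM2r ?rnorm_ge0// lerDl.
have pc x : rnorm (p x) ^+ 2 <= c * rdt (p x) x.
  by apply: (positive_norm_le dotE lp sp (ltW cp)) => z; rewrite p0 hc.
(* Polarization of |m x| = |p x|. *)
have pol a b : rdt (m a) (m b) = rdt (p a) (p b).
  have h : rnorm (m (a + b)) ^+ 2 = rnorm (p (a + b)) ^+ 2 by rewrite np.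
  move: h; rewrite (lin_add lm) (lin_add lp) !(rnormD_sqr dotE) !np; lra.
have range w : 2 * rdt (m (p w)) y <= t * rdt (p (p w)) (p w) + t^-1 * rdt (p y) y.
  have := p0 (t%:C *: m w - y).
  rewrite (lin_sub lp) (lin_scale lp) -com !(rdotE, rdotDr, rdotNr, rdotZr).
  rewrite pol (_ : rdt (p y) (m w) = rdt (m (p w)) y); last first.
    by rewrite sp com rdotC.
  set a := rdt (p (p w)) _; set b := rdt (m _) y; set d := rdt (p y) y => h.
  have -> : t * a + t^-1 * d = t^-1 * (t * (t * a) - t * b + (t * - b - - d)) + 2 * b.
    by field; rewrite gt_eqF.
  by rewrite lerDr mulr_ge0 ?invr_ge0 ?(ltW t0).
apply/ler_addgt0Pr => e e0.
(* Write v = p w + u with <p u, u> <= d. The choice of d gives both <p u, u> <= s and |p u| <= s,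
   the latter through |p u|^2 <= c <p u, u>. Replacing p w by v then costs at most s (2 t |v| + t +
   2 |y|), which is below s L = e; the final 1 keeps L positive. *)
pose L := 2 * t * rnorm v + t + 2 * rnorm y + 1.
have nv := rnorm_ge0 v; have ny := rnorm_ge0 y.
have L0 : 0 < L by rewrite /L; nra.
pose s := e / L; have s0 : 0 < s by rewrite divr_gt0.
pose d := Num.min s (s ^+ 2 / c).
have d0 : 0 < d by rewrite lt_min s0 divr_gt0// exprn_gt0.
have [w [u [vE hw]]] : exists w u, v = p w + u /\ rdt (p u) u <= d.
  have [w hw] := positive_approx v lp cp p0 pc d0.
  by exists w, (v - p w); rewrite addrC subrK.
have pu : rnorm (p u) <= s.
  rewrite -ler_sqr ?nnegrE ?rnorm_ge0 ?(ltW s0)//; apply: le_trans (pc u) _.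
  rewrite mulrC -ler_pdivlMr//; apply: le_trans hw _.
  by rewrite ge_min lexx orbT.
have qu : rdt (p u) u <= s by apply: le_trans hw _; rewrite ge_min lexx.
have h1 := range w.
have h2 : rdt (m v) y <= rdt (m (p w)) y + s * rnorm y.
  rewrite {1}vE (lin_add lm) rdotDl lerD2l.
  apply: le_trans (rdot_le dotE _ _) _.
  by rewrite -np ler_wpM2r.
have h3 : rdt (p (p w)) (p w) <= rdt (p v) v + 2 * (s * rnorm v) + s.
  have -> : p w = v - u by rewrite vE addrK.
  rewrite (lin_sub lp) !(rdotE, rdotDr, rdotNr, rdotZr).
  rewrite (_ : rdt (p v) u = rdt (p u) v); last by rewrite sp rdotC.
  have : - rdt (p u) v <= s * rnorm v.
    apply: le_trans (ler_norm _) _; rewrite normrN.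
    by apply: le_trans (ler_norm_rdot dotE _ _) _; rewrite ler_wpM2r.
  by move: qu; lra.
have h4 := ler_wpM2l (ltW t0) h3.
have eL : e = s * L by rewrite divfK ?gt_eqF.
rewrite eL /L; move: h1 h2 h4; set X := rdt (m _) _; set Y := rdt (m v) y.
set a := rdt (p (p w)) _; set b := rdt (p v) v; set g := t^-1 * _.
by move: s0; lra.
Qed.

End MixedSchwarz.

(** * Operator series dominated by real series of quadratic weights *)

Section DominatedSeries.
Variables (R : realType) (H : completeNormedModType R[i]).
Variable dot : {dot H for Num.conj}.
Hypothesis dotE : forall x : H, dot x x = `|x| ^+ 2.

(* Schwarz in the form 2 <z, y> <= C q + r / C, applied with y = sum_i z_i. *)
Lemma rnorm_sum_le (I : Type) (s : seq I) (z : I -> H) (q : I -> R)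
    (r : I -> H -> R) (C : R) : 0 < C ->
  (forall i y, 2 * `|rdot dot (z i) y| <= C * q i + C^-1 * r i y) ->
  (forall y, \sum_(i <- s) r i y <= C * rnorm y ^+ 2) ->
  rnorm (\sum_(i <- s) z i) ^+ 2 <= C * \sum_(i <- s) q i.
Proof.
move=> C0 h hr; set y := \sum_(i <- s) z i.
have : 2 * rnorm y ^+ 2 <= C * (\sum_(i <- s) q i) + C^-1 * \sum_(i <- s) r i y.
  rewrite -(rdotxx dotE) {1}/y rdot_suml !mulr_sumr -big_split /=.
  apply: ler_sum => i _; apply: le_trans (h i y).
  by rewrite ler_wpM2l// ler_norm.
have : C^-1 * \sum_(i <- s) r i y <= rnorm y ^+ 2.
  by rewrite mulrC ler_pdivrMr// mulrC.
by lra.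
Qed.

Variables (T : nat -> H -> H) (q : nat -> H -> R) (C K : R).
Hypotheses (linT : forall n, linear (T n)) (C0 : 0 < C) (K0 : 0 <= K).
Hypothesis q0 : forall n x, 0 <= q n x.
Hypothesis qK : forall x n, \sum_(0 <= k < n) q k x <= K * rnorm x ^+ 2.
Hypothesis hT : forall x a b,
  rnorm (\sum_(a <= k < b) T k x) ^+ 2 <= C * \sum_(a <= k < b) q k x.

Lemma sum_block (V : zmodType) (f : nat -> V) (a b : nat) : (a <= b)%N ->
  \sum_(0 <= k < b) f k - \sum_(0 <= k < a) f k = \sum_(a <= k < b) f k.
Proof. by move=> ab; rewrite (big_cat_nat (leq0n a) ab) /= addrC addrK. Qed.

Lemma bounded_sum_tail (f : nat -> R) (M : R) : (forall n, 0 <= f n) ->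
  (forall n, \sum_(0 <= k < n) f k <= M) ->
  forall e : R, 0 < e -> exists N, forall a b, (N <= a)%N ->
    \sum_(a <= k < b) f k <= e.
Proof.
move=> f0 hM e e0; pose F n := \sum_(0 <= k < n) f k.
have incr : {homo F : n m / (n <= m)%N >-> n <= m}.
  move=> n m nm; rewrite -subr_ge0 /F sum_block//.
  exact: sumr_ge0.
have cF : cvgn F.
  by apply: nondecreasing_is_cvgn => //; exists M => _ [n _ <-]; exact: hM.
have /cvgrPdist_le/(_ _ e0)[N _ hN] := cF.
exists N => a b Na; have [ab|/ltnW ba] := leqP a b; last by rewrite big_geq// ltW.
rewrite -sum_block//; have h := le_trans (ler_norm _) (hN a Na); apply: le_trans h.
by rewrite lerD2r; apply: nondecreasing_cvgn_le.
Qed.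

(** For fixed x the weights form a bounded series of nonnegative reals, so its blocks, and with them
    those of T, become small. Blocks starting at 0 bound all partial sums by sqrt (C K), which makes
    the limit bounded. *)
Lemma dominated_sot_series : exists S, sot_series T S.
Proof.
pose P n := fun x => \sum_(0 <= k < n) T k x.
have linP n : linear (P n).
  move=> c x y; rewrite /P scaler_sumr -big_split /=.
  by apply: eq_bigr => k _; rewrite linT.
have hP n x : rnorm (P n x) <= Num.sqrt (C * K) * rnorm x.
  rewrite -ler_sqr ?nnegrE ?mulr_ge0 ?sqrtr_ge0 ?rnorm_ge0//.
  rewrite exprMn sqr_sqrtr ?mulr_ge0 ?(ltW C0)//.
  by apply: le_trans (hT x 0 n) _; rewrite -mulrA ler_wpM2l ?(ltW C0).
have cP x : exists l, vcvg (fun n => P n x) l.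
  apply: vcvg_cauchy => e e0.
  have ec : 0 < e ^+ 2 / C by rewrite divr_gt0 ?exprn_gt0.
  have [N hN] := bounded_sum_tail (q0^~ x) (qK x) ec.
  exists N => n k Nn nk; rewrite -ler_sqr ?nnegrE ?rnorm_ge0 ?(ltW e0)//.
  rewrite /P sum_block//; apply: le_trans (hT x n k) _.
  by rewrite mulrC -ler_pdivlMr// hN.
have [S [bS hS _]] := pointwise_limit linP (sqrtr_ge0 _) hP cP.
exists S; apply/sot_seriesP; split=> // x.
by apply: (vcvg_ext _ (hS x)) => n; rewrite /P big_mkord.
Qed.

Lemma dominated_norm_series :
  (forall e : R, 0 < e -> exists N, forall b x,
    \sum_(N <= k < b) q k x <= e * rnorm x ^+ 2) ->
  exists S, norm_series T S.
Proof.
move=> tail; have [S hS] := dominated_sot_series; exists S.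
have [bS {}hS] := (sot_seriesP T S).1 hS; have [linS _] := bS.
apply/(norm_seriesP _ linT); split=> // e e0.
have ec : 0 < e ^+ 2 / C by rewrite divr_gt0 ?exprn_gt0.
have [N hN] := tail _ ec; exists N => n Nn x.
rewrite rnormBC.
(* The remainder after n terms is the limit of the blocks from n to b + n, whose bound is uniform in
   x. *)
have shift : vcvg (fun b => \sum_(0 <= k < b + n) T k x - \sum_(k < n) T k x)
    (S x - \sum_(k < n) T k x).
  apply: vcvgD (vcvg_cst _); apply/vcvgE => d d0.
  have [M hM] := (vcvgE _ _).1 (hS x) d d0; exists M => b Mb.
  by rewrite big_mkord hM// (leq_trans Mb)// leq_addr.
apply: (vcvg_le shift) => b; rewrite -(big_mkord xpredT (T^~ x)) sum_block ?leq_addl//.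
rewrite -ler_sqr ?nnegrE ?mulr_ge0 ?rnorm_ge0 ?(ltW e0)//.
apply: le_trans (hT _ _ _) _; rewrite mulrC -ler_pdivlMr// exprMn mulrAC.
apply: le_trans (hN (b + n)%N x).
rewrite [leRHS](@big_cat_nat _ _ _ n)//= ?leq_addl// lerDr.
exact: sumr_ge0.
Qed.

End DominatedSeries.

(** * Square-summable sequences *)

Section SquareSummable.
Variables (R : realType) (H : completeNormedModType R[i]).
Variable dot : {dot H for Num.conj}.
Hypothesis dotE : forall x : H, dot x x = `|x| ^+ 2.
Variable A : set (H -> H).
Hypotheses (vnA : von_neumann_algebra dot A) (comA : commutative_algebra A).
Implicit Types (S T : H -> H) (x y z : H) (a b : nat -> H -> H).

Local Notation rdt := (rdot dot).

Lemma sot_series_rdot (P : nat -> H -> H) S x y : sot_series P S ->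
  (fun n => \sum_(0 <= k < n) rdt (P k x) y) @ \oo --> rdt (S x) y.
Proof.
move=> /sot_seriesP[_ /(_ x) h]; have := rdot_cvg (y := y) dotE h.
suff -> : (fun n => rdot dot (\sum_(k < n) P k x) y) =
  (fun n => \sum_(0 <= k < n) rdt (P k x) y) by [].
by apply/funext => n; rewrite rdot_suml big_mkord.
Qed.

(** The partial forms increase to <S x, x>, and for a positive self-adjoint operator a bound on the
    form is a bound on the norm. This translates both the hypotheses on the sums of p_jk and the
    module norms into inequalities between finite real sums. *)
Lemma sot_positive_opnorm (P : nat -> H -> H) S (c : R) : sot_series P S ->
  (forall k, selfadj dot (P k)) -> (forall k x, 0 <= rdt (P k x) x) -> 0 <= c ->
  (opnorm S <= c%:E)%E <->
  forall n x, \sum_(0 <= k < n) rdt (P k x) x <= c * rnorm x ^+ 2.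
Proof.
move=> hS sP P0 c0; have [[lS _] _] := hS.
have cv x := sot_series_rdot (x := x) (y := x) hS.
have incr x : {homo (fun n => \sum_(0 <= k < n) rdt (P k x) x) :
    n m / (n <= m)%N >-> n <= m}.
  by move=> n m nm /=; rewrite -subr_ge0 sum_block//; exact: sumr_ge0.
have leS n x : \sum_(0 <= k < n) rdt (P k x) x <= rdt (S x) x.
  rewrite -(cvg_lim (@Rhausdorff R) (cv x)).
  by apply: nondecreasing_cvgn_le (incr x) _ n; apply/cvg_ex; exists (rdt (S x) x).
rewrite opnorm_leP//; split=> [h n x|h].
  apply: le_trans (leS n x) _; apply: le_trans (rdot_le dotE _ _) _.
  by rewrite expr2 mulrA ler_wpM2r ?rnorm_ge0.
have Sle x : rdt (S x) x <= c * rnorm x ^+ 2.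
  rewrite -(cvg_lim (@Rhausdorff R) (cv x)).
  apply: limr_le; first by apply/cvg_ex; exists (rdt (S x) x).
  by apply: nearW => n; exact: h.
apply: (positive_bound dotE lS) => // [x y|x].
  have h1 := sot_series_rdot (x := x) (y := y) hS; have h2 := sot_series_rdot (x := y) (y := x) hS.
  have E : (fun n => \sum_(0 <= k < n) rdt (P k x) y) =
      (fun n => \sum_(0 <= k < n) rdt (P k y) x).
    by apply/funext => n; apply: eq_bigr => k _; rewrite sP rdotC.
  by rewrite E in h1; rewrite (rdotC _ x); apply: (cvg_unique _ h1 h2).
by rewrite Sle andbT; apply: le_trans (leS 0 x); rewrite big_geq.
Qed.

Definition vsum a n x : R := \sum_(0 <= k < n) rnorm (a k x) ^+ 2.

Lemma rdot_sqr T x : A T -> rdt ((T \o adjoint dot T) x) x = rnorm (T x) ^+ 2.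
Proof.
move=> AT; rewrite /= (vn_rdotr dotE vnA AT) (rdotxx dotE).
by rewrite (vn_adj_norm dotE vnA comA).
Qed.

Lemma vn_sqr T : A T -> A (T \o adjoint dot T).
Proof. by move=> AT; apply: (vn_comp vnA) => //; apply: vn_adj. Qed.

Lemma selfadj_sqr T : A T -> selfadj dot (T \o adjoint dot T).
Proof.
by move=> AT x y; rewrite /= (vn_rdotr dotE vnA AT) -[in RHS](vn_rdotl dotE vnA AT).
Qed.

Lemma vsum_partial a n x : (forall k, A (a k)) ->
  rdt ((\sum_(k < n) (a k \o adjoint dot (a k))) x) x = vsum a n x.
Proof.
move=> Aa; rewrite fct_sumE rdot_suml /vsum big_mkord.
by apply: eq_bigr => k _; exact: rdot_sqr.
Qed.

Lemma l2strongP a : l2strong dot A a <->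
  (forall k, A (a k)) /\
  exists2 K : R, 0 <= K & forall n x, vsum a n x <= K * rnorm x ^+ 2.
Proof.
pose P n := \sum_(k < n) (a k \o adjoint dot (a k)).
split=> -[Aa]; have AP n : A (P n).
- by apply: (vn_sum vnA) => k; exact: vn_sqr.
- set s := ereal_sup _ => hs; split=> //.
  have sP n : (opnorm (P n) <= s)%E by apply: ereal_sup_ubound; exists n.
  have s0 : (0 <= s)%E by apply: le_trans (sP 0%N); apply/opnorm_ge0/(vn_blinear vnA).
  have fs : s \is a fin_num by rewrite ge0_fin_numE.
  exists (fine s) => [|n x]; first exact: fine_ge0.
  have := sP n; rewrite -(fineK fs) => /(opnorm_leP (vn_blinear vnA (AP n)) (fine_ge0 s0)).
  move=> /(_ x) h; rewrite -vsum_partial//; apply: le_trans (rdot_le dotE _ _) _.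
  by rewrite expr2 mulrA ler_wpM2r ?rnorm_ge0.
- by apply: (vn_sum vnA) => k; exact: vn_sqr.
- move=> [K K0 hK]; split=> //; apply: le_lt_trans (ltry K).
  apply: ge_ereal_sup => _ [n _ <-]; rewrite -/(P n).
  have lP := vn_blinear vnA (AP n); apply/opnorm_leP => //.
  apply: (positive_bound dotE lP) => // [x y|x].
    rewrite /P !fct_sumE rdot_suml rdotC rdot_suml; apply: eq_bigr => k _.
    by rewrite selfadj_sqr// rdotC.
  rewrite vsum_partial// hK andbT.
  by apply: sumr_ge0 => k _; exact: sqr_ge0.
Qed.

Lemma l2strong_vn a k : l2strong dot A a -> A (a k). Proof. by case. Qed.

(** Commutativity moves the adjoint to the outside; the terms of the module inner product thus
    become <a_n x, b_n y>. *)
Lemma rdot_comp_adjoint S T x y : A S -> A T ->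
  rdt ((S \o adjoint dot T) x) y = rdt (S x) (T y).
Proof.
move=> AS AT; rewrite /=.
by rewrite (vn_comm comA AS (vn_adj dotE vnA AT)) (vn_rdotl dotE vnA AT).
Qed.

Lemma amgm (C s t : R) : 0 < C -> 2 * (s * t) <= C * s ^+ 2 + C^-1 * t ^+ 2.
Proof.
move=> C0; rewrite -subr_ge0.
have -> : C * s ^+ 2 + C^-1 * t ^+ 2 - 2 * (s * t) = C^-1 * (C * s - t) ^+ 2.
  by field; rewrite gt_eqF.
by rewrite mulr_ge0 ?sqr_ge0// invr_ge0 ltW.
Qed.

(** By normality |<a_k b_k^* x, y>| <= |b_k x| |a_k y|, so |b_k x|^2 serves as dominating weight and
    |a_k y|^2 as test weight. *)
Lemma l2strong_ip_series a b : l2strong dot A a -> l2strong dot A b ->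
  sot_series (fun n => a n \o adjoint dot (b n)) (l2strong_ip dot a b).
Proof.
move=> /l2strongP[Aa [Ka Ka0 ha]] /l2strongP[Ab [Kb Kb0 hb]].
pose C := Ka + 1; have C0 : 0 < C by rewrite ltr_wpDl.
suff [S hS] : exists S, sot_series (fun n => a n \o adjoint dot (b n)) S.
  by rewrite /l2strong_ip (sot_sumE hS).
apply: (@dominated_sot_series _ _ _ (fun k x => rnorm (b k x) ^+ 2) C Kb) => //.
- by move=> n; apply/(vn_blinear vnA)/(vn_comp vnA) => //; apply: vn_adj.
- by move=> n x; exact: sqr_ge0.
- by move=> x n; exact: hb.
move=> x i j; apply: (@rnorm_sum_le _ _ _ dotE _ _ _ _ (fun k y => rnorm (a k y) ^+ 2)) => //.
  move=> k y; apply: le_trans (amgm _ _ C0); rewrite ler_pM2l//=.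
  rewrite (vn_rdotr dotE vnA (Aa k)).
  rewrite -(vn_adj_norm dotE vnA comA (Aa k)) -(vn_adj_norm dotE vnA comA (Ab k)).
  exact: ler_norm_rdot.
move=> y; have [ij|/ltnW ji] := leqP i j; last first.
  by rewrite big_geq// mulr_ge0 ?sqr_ge0// ltW.
apply: le_trans (_ : vsum a j y <= _).
  by rewrite /vsum [leRHS](@big_cat_nat _ _ _ i)//= lerDr sumr_ge0// => k _; exact: sqr_ge0.
by apply: le_trans (ha _ _) _; rewrite ler_wpM2r ?sqr_ge0// lerDl.
Qed.

Lemma l2strong_normP a (c : R) : l2strong dot A a -> 0 <= c ->
  (l2strong_norm dot a <= c%:E)%E <->
  forall n x, vsum a n x <= c ^+ 2 * rnorm x ^+ 2.
Proof.
move=> ha c0; have Aa k := l2strong_vn k ha.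
have hS := l2strong_ip_series ha ha.
have -> : (forall n x, vsum a n x <= c ^+ 2 * rnorm x ^+ 2) <->
    (opnorm (l2strong_ip dot a a) <= (c ^+ 2)%:E)%E.
  rewrite (sot_positive_opnorm hS) ?sqr_ge0//.
  - by split=> h n x; have := h n x; under eq_bigr do rewrite rdot_sqr//.
  - by move=> k; exact: selfadj_sqr.
  - by move=> k x; rewrite rdot_sqr// sqr_ge0.
have [lS bS] := hS.1; have S0 := opnorm_ge0 lS.
rewrite /l2strong_norm; have fS : opnorm (l2strong_ip dot a a) \is a fin_num.
  by rewrite ge0_fin_numE.
rewrite -(fineK fS) in S0 *; move: (fine _) S0 => r; rewrite lee_fin => r0 /=.
by rewrite !lee_fin -(ler_sqr (sqrtr_ge0 r)) ?nnegrE// sqr_sqrtr.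
Qed.

(** N does not depend on x: this uniformity distinguishes l2 from l2strong, and it is what makes the
    rows of the matrix converge in norm. *)
Lemma l2_tail a : l2 dot A a -> forall e : R, 0 < e -> exists N, forall i x,
  \sum_(N <= k < i) rnorm (a k x) ^+ 2 <= e * rnorm x ^+ 2.
Proof.
move=> [Aa [S /norm_seriesP h]] e e0.
have lin n : linear (a n \o adjoint dot (a n)) by apply/(vn_blinear vnA)/vn_sqr.
have [bS /(_ (e / 2))] := h lin; rewrite divr_gt0// => /(_ isT)[N hN].
exists N => i x; have [Ni|/ltnW iN] := leqP N i; last first.
  by rewrite big_geq// mulr_ge0 ?sqr_ge0// ltW.
rewrite -sum_block// -!/(vsum a _ x) -!vsum_partial// -rdotNl -rdotDl.
apply: le_trans (rdot_le dotE _ _) _; rewrite expr2 mulrA ler_wpM2r ?rnorm_ge0//.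
rewrite !fct_sumE; set u := \sum_(_ < i) _; set v := \sum_(_ < N) _.
have -> : u - v = (u - S x) + (S x - v) by rewrite addrA subrK.
apply: le_trans (ler_rnormD _ _) _; rewrite [e in leRHS]splitr mulrDl.
by apply: lerD; [exact: hN | rewrite rnormBC; exact: hN].
Qed.

Lemma l2_l2strong a : l2 dot A a -> l2strong dot A a /\ l2_norm dot a = l2strong_norm dot a.
Proof.
move=> [Aa [S hS]].
have lin n : linear (a n \o adjoint dot (a n)) by apply/(vn_blinear vnA)/vn_sqr.
have hS' := norm_sot_series lin hS; split; last first.
  by rewrite /l2_norm /l2strong_norm /l2_ip /l2strong_ip (norm_sumE lin hS) (sot_sumE hS').
apply/l2strongP; split=> //; have [bS _] := hS.
have /bounded_opP[lS [c c0 hc]] := bS; exists c => // n x.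
have /(sot_positive_opnorm hS') : (opnorm S <= c%:E)%E by apply/opnorm_leP.
move=> /(_ (fun k => selfadj_sqr (Aa k)) _ c0 n x); rewrite /vsum.
under eq_bigr do rewrite rdot_sqr//.
by apply => k y; rewrite rdot_sqr// sqr_ge0.
Qed.

End SquareSummable.

(** * The Schur test *)

Section RealDoubleSeries.
Variable R : realType.

Lemma cvg_sum_nat (f : nat -> nat -> R) (l : nat -> R) (J : nat) :
  (forall j, f j @ \oo --> l j) ->
  (fun n => \sum_(0 <= j < J) f j n) @ \oo --> \sum_(0 <= j < J) l j.
Proof.
move=> h; elim: J => [|J IH].
  rewrite big_geq// (_ : (fun n => _) = fun=> 0); first exact: cvg_cst.
  by apply/funext => n; rewrite big_geq.
rewrite big_nat_recr//= (_ : (fun n => _) =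
    (fun n => \sum_(0 <= j < J) f j n + f J n)); first exact: cvgD.
by apply/funext => n; rewrite big_nat_recr.
Qed.

Lemma cvg_norm_le (f : nat -> R) (l c : R) (N : nat) : f @ \oo --> l ->
  (forall n, (N <= n)%N -> `|f n| <= c) -> `|l| <= c.
Proof.
move=> fl h; have nf : (fun n => `|f n|) @ \oo --> `|l| by apply: cvg_norm.
rewrite -(cvg_lim (@Rhausdorff R) nf).
by apply: limr_le; [apply/cvg_ex; exists `|l| | exists N].
Qed.

(** In place of absolute convergence, blocks of late columns are small uniformly in the number n of
    rows. Letting b and then n tend to infinity leaves |X - sum_(k < a) g k| <= e, so the series of
    g tends to X as well. *)
Lemma iterated_series_eq (c : nat -> nat -> R) (f g : nat -> R) (X Y : R) :
  (forall j, (fun n => \sum_(0 <= k < n) c j k) @ \oo --> f j) ->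
  (forall k, (fun n => \sum_(0 <= j < n) c j k) @ \oo --> g k) ->
  (fun n => \sum_(0 <= j < n) f j) @ \oo --> X ->
  (fun n => \sum_(0 <= k < n) g k) @ \oo --> Y ->
  (forall e : R, 0 < e -> exists N, forall a b n, (N <= a)%N ->
    `|\sum_(0 <= j < n) \sum_(a <= k < b) c j k| <= e) ->
  X = Y.
Proof.
move=> hf hg hX hY tail; apply: (cvg_unique _ _ hY) => //.
apply/cvgrPdist_le => e e0; have [N hN] := tail e e0; exists N => // a Na /=.
have hga : (fun n => \sum_(0 <= j < n) f j -
    \sum_(0 <= j < n) \sum_(0 <= k < a) c j k) @ \oo --> X - \sum_(0 <= k < a) g k.
  apply: cvgB => //.
  rewrite (_ : (fun n => _) = (fun n => \sum_(0 <= k < a) \sum_(0 <= j < n) c j k)).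
    exact: cvg_sum_nat.
  by apply/funext => n; rewrite exchange_big_nat.
apply: (cvg_norm_le (N := 0) hga) => n _.
have hfn : (fun b => \sum_(0 <= j < n) \sum_(0 <= k < b) c j k -
    \sum_(0 <= j < n) \sum_(0 <= k < a) c j k) @ \oo -->
    \sum_(0 <= j < n) f j - \sum_(0 <= j < n) \sum_(0 <= k < a) c j k.
  by apply: cvgB; [exact: cvg_sum_nat | exact: cvg_cst].
apply: (cvg_norm_le (N := a) hfn) => b ab.
rewrite -sumrB (eq_bigr (fun j => \sum_(a <= k < b) c j k)); first exact: hN.
by move=> j _; rewrite sum_block.
Qed.

End RealDoubleSeries.

Section SchurTest.
Variables (R : realType) (H : completeNormedModType R[i]).
Variable dot : {dot H for Num.conj}.
Hypothesis dotE : forall x : H, dot x x = `|x| ^+ 2.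
Variable A : set (H -> H).
Hypotheses (vnA : von_neumann_algebra dot A) (comA : commutative_algebra A).
Implicit Types (x y z : H) (a b : nat -> H -> H).

Local Notation rdt := (rdot dot).

(** The extension of [matrix_map]: the sum is strong, because for a in l2strong a row need not
    converge in norm. *)
Definition schur (m : nat -> nat -> H -> H) a : nat -> H -> H :=
  fun j => sot_sum (fun k => m j k \o a k).

(* q j k x stands for <|m_jk| x, x>; the hypotheses on (m, q, Bc, Br) also hold for
   the adjoint matrix, the transpose of q and (Br, Bc). *)
Variables (m : nat -> nat -> H -> H) (q : nat -> nat -> H -> R) (Bc Br : R).
Hypotheses (mA : forall j k, A (m j k)) (Bc0 : 0 < Bc) (Br0 : 0 < Br).
Hypothesis q0 : forall j k x, 0 <= q j k x.
Hypothesis q_schwarz : forall j k (t : R) v y, 0 < t ->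
  2 * `|rdt (m j k v) y| <= t * q j k v + t^-1 * q j k y.
Hypothesis q_col : forall k n x, \sum_(0 <= j < n) q j k x <= Bc * rnorm x ^+ 2.
Hypothesis q_row : forall j n x, \sum_(0 <= k < n) q j k x <= Br * rnorm x ^+ 2.

Lemma schur_row_le j k x : q j k x <= Br * rnorm x ^+ 2.
Proof.
apply: le_trans (q_row j k.+1 x); rewrite big_nat_recr//= lerDr.
by apply: sumr_ge0.
Qed.

Lemma schur_row_block j x i l : \sum_(i <= k < l) q j k x <= Br * rnorm x ^+ 2.
Proof.
have [il|/ltnW li] := leqP i l; last first.
  by rewrite big_geq// mulr_ge0 ?sqr_ge0// ltW.
apply: le_trans (q_row j l x); rewrite [leRHS](@big_cat_nat _ _ _ i)//= lerDr.
by apply: sumr_ge0.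
Qed.

Lemma schur_block j (v : nat -> H) i l :
  rnorm (\sum_(i <= k < l) m j k (v k)) ^+ 2 <= Br * \sum_(i <= k < l) q j k (v k).
Proof.
apply: (rnorm_sum_le dotE (r := fun k y => q j k y)) => // [k y|y].
  exact: q_schwarz.
exact: schur_row_block.
Qed.

Lemma schur_linear a j k : A (a k) -> linear (m j k \o a k).
Proof. by move=> ?; apply/(vn_blinear vnA)/(vn_comp vnA). Qed.

(** A crude bound on single weights, enough for convergence of one row; the sharp constant comes
    from the column sums in [schur_vsum_le]. *)
Lemma schur_weight_le a j x i l : \sum_(i <= k < l) q j k (a k x) <=
  Br * \sum_(i <= k < l) rnorm (a k x) ^+ 2.
Proof. by rewrite mulr_sumr; apply: ler_sum => k _; exact: schur_row_le. Qed.

Lemma schur_series a j : l2strong dot A a ->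
  sot_series (fun k => m j k \o a k) (schur m a j).
Proof.
move=> /(l2strongP dotE vnA comA)[Aa [K K0 hK]].
suff [S hS] : exists S, sot_series (fun k => m j k \o a k) S.
  by rewrite /schur (sot_sumE hS).
apply: (@dominated_sot_series _ _ _ (fun k x => q j k (a k x)) Br (Br * K)) => //.
- by move=> k; exact: schur_linear.
- by rewrite mulr_ge0// ltW.
- move=> x n; apply: le_trans (schur_weight_le _ _ _ _ _) _.
  by rewrite -mulrA ler_pM2l//; exact: hK.
- by move=> x i l; exact: (schur_block j (fun k => a k x)).
Qed.

Lemma schur_norm_series a j : l2 dot A a ->
  exists S, norm_series (fun k => m j k \o a k) S.
Proof.
move=> la; have [ls _] := l2_l2strong dotE vnA comA la.
have [Aa [K K0 hK]] := (l2strongP dotE vnA comA a).1 ls.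
apply: (@dominated_norm_series _ _ _ (fun k x => q j k (a k x)) Br (Br * K)) => //.
- by move=> k; exact: schur_linear.
- by rewrite mulr_ge0// ltW.
- move=> x n; apply: le_trans (schur_weight_le _ _ _ _ _) _.
  by rewrite -mulrA ler_pM2l//; exact: hK.
- by move=> x i l; exact: (schur_block j (fun k => a k x)).
move=> e e0; have eB : 0 < e / Br by rewrite divr_gt0.
have [N hN] := l2_tail dotE vnA comA la eB; exists N => l x.
apply: le_trans (schur_weight_le _ _ _ _ _) _.
rewrite mulrC -ler_pdivlMr// mulrAC; exact: hN.
Qed.

Lemma schur_vn a j : l2strong dot A a -> A (schur m a j).
Proof.
move=> la; have [bS hS] := (sot_seriesP _ _).1 (schur_series j la).
apply: (vn_limit vnA (T := fun n => \sum_(k < n) (m j k \o a k))) => // [n|x].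
  by apply: (vn_sum vnA) => k; apply: (vn_comp vnA) => //; exact: l2strong_vn la.
by apply: (vcvg_ext _ (hS x)) => n; rewrite fct_sumE.
Qed.

(** The rows are truncated to l columns, so that the double sum of weights is finite, can be
    exchanged and bounded column by column; the bound is uniform in l and survives the limit. *)
Lemma schur_vsum_le a (K : R) n x : l2strong dot A a ->
  (forall n x, vsum a n x <= K * rnorm x ^+ 2) ->
  vsum (schur m a) n x <= Br * Bc * K * rnorm x ^+ 2.
Proof.
move=> la hK.
have cv : (fun l => \sum_(0 <= j < n) rnorm (\sum_(0 <= k < l) m j k (a k x)) ^+ 2)
    @ \oo --> vsum (schur m a) n x.
  apply: cvg_sum_nat => j; have [_ hS] := (sot_seriesP _ _).1 (schur_series j la).
  apply: (rnorm_cvg dotE); apply: (vcvg_ext _ (hS x)) => l.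
  by rewrite big_mkord.
rewrite -(cvg_lim (@Rhausdorff R) cv).
apply: limr_le; first by apply/cvg_ex; exists (vsum (schur m a) n x).
apply: nearW => l; apply: (@le_trans _ _ (Br * \sum_(0 <= j < n) \sum_(0 <= k < l) q j k (a k x))).
  by rewrite mulr_sumr; apply: ler_sum => j _; exact: (schur_block j (fun k => a k x)).
rewrite -!mulrA ler_pM2l// exchange_big_nat//=.
apply: (@le_trans _ _ (Bc * vsum a l x)); last by rewrite ler_pM2l.
by rewrite /vsum mulr_sumr; apply: ler_sum => k _; exact: q_col.
Qed.

Lemma schur_l2strong a : l2strong dot A a -> l2strong dot A (schur m a).
Proof.
move=> la; have [Aa [K K0 hK]] := (l2strongP dotE vnA comA a).1 la.
apply/(l2strongP dotE vnA comA); split=> [j|]; first exact: schur_vn.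
exists (Br * Bc * K) => [|n x]; last exact: schur_vsum_le.
by rewrite !mulr_ge0// ltW.
Qed.

Lemma schur_norm_le : (map_norm (l2strong dot A) (l2strong_norm dot)
  (l2strong_norm dot) (schur m) <= (Num.sqrt (Br * Bc))%:E)%E.
Proof.
apply: ge_ereal_sup => _ [a [la /(l2strong_normP dotE vnA comA la ler01) na] <-].
apply/(l2strong_normP dotE vnA comA (schur_l2strong la) (sqrtr_ge0 _)) => n x.
rewrite sqr_sqrtr ?mulr_ge0 ?(ltW Br0) ?(ltW Bc0)// -[Br * Bc]mulr1.
by apply: schur_vsum_le => // {}n {}x; have := na n x; rewrite expr1n.
Qed.

Lemma schur_matrix_map a : l2 dot A a -> schur m a = matrix_map m a.
Proof.
move=> la; have [ls _] := l2_l2strong dotE vnA comA la.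
apply/funext => j; have [S hS] := schur_norm_series j la.
have lin k : linear (m j k \o a k) by apply: schur_linear; exact: l2strong_vn ls.
by rewrite /schur /matrix_map (norm_sumE lin hS) (sot_sumE (norm_sot_series lin hS)).
Qed.

Lemma matrix_map_module : module_map A (l2 dot A) (l2strong dot A) (matrix_map m).
Proof.
split=> [a la|c a b Ac la lb].
  have [ls _] := l2_l2strong dotE vnA comA la.
  by rewrite -schur_matrix_map//; exact: schur_l2strong.
have Aa k : A (a k) by case: la.
have Ab k : A (b k) by case: lb.
have Aab k : A ((act c a + b) k).
  by apply: (vn_add vnA) => //; apply: (vn_comp vnA).
apply/funext => j; have [S hS] := schur_norm_series j la.
have [T hT] := schur_norm_series j lb.
have lc := vn_blinear vnA Ac.
have linS k := schur_linear j (Aa k); have linT k := schur_linear j (Ab k).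
have eS : matrix_map m a j = S by exact: norm_sumE.
have eT : matrix_map m b j = T by exact: norm_sumE.
have -> : (act c (matrix_map m a) + matrix_map m b) j = (c \o S) + T.
  by rewrite -eS -eT.
apply: norm_sumE; first by move=> k; exact: schur_linear.
have {hS}[bS hS] := (norm_seriesP S linS).1 hS.
have {hT}[bT hT] := (norm_seriesP T linT).1 hT.
apply/norm_seriesP; first by move=> k; exact: schur_linear.
have /bounded_opP[_ [c1 c10 hc]] := vn_bounded vnA Ac.
have /bounded_opP[lS [s s0 hs]] := bS; have /bounded_opP[lT [t t0 ht]] := bT.
split.
  apply/bounded_opP; split.
    move=> d x y; rewrite /GRing.add /= lS lT lc scalerDr.
    by rewrite addrACA.
  exists (c1 * s + t) => [|x]; first by rewrite addr_ge0 ?mulr_ge0.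
  apply: le_trans (ler_rnormD _ _) _; rewrite mulrDl lerD//=.
  by apply: le_trans (hc _) _; rewrite -mulrA ler_wpM2l.
(* The error in S is amplified by c, of norm at most c1, so it is taken below e / (2 (c1 + 1)); the
   added 1 covers c1 = 0. *)
move=> e e0; have d0 : 0 < c1 + 1 by rewrite ltr_wpDl.
have [N1 h1] := hS _ (divr_gt0 e0 (mulr_gt0 (ltr0n _ 2) d0)).
have [N2 h2] := hT _ (divr_gt0 e0 (ltr0n _ 2)).
exists (maxn N1 N2) => n; rewrite geq_max => /andP[n1 n2] x.
have -> : \sum_(k < n) (m j k \o (act c a + b) k) x - ((c \o S) + T) x =
    c (\sum_(k < n) (m j k \o a k) x - S x) + (\sum_(k < n) (m j k \o b k) x - T x).
  rewrite (lin_sub lc) (lin_sum lc) addrACA -opprD -big_split /=.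
  congr (_ - _); apply: eq_bigr => k _; rewrite /= /act.
  rewrite (lin_add (vn_blinear vnA (mA j k))).
  by rewrite (vn_comm comA (mA j k) Ac).
apply: le_trans (ler_rnormD _ _) _; rewrite [e]splitr mulrDl lerD ?h2//.
apply: le_trans (hc _) _; apply: le_trans (ler_wpM2l c10 (h1 n n1 x)) _.
rewrite mulrA; apply: ler_wpM2r; first exact: rnorm_ge0.
have -> : c1 * (e / (2 * (c1 + 1))) = e / 2 * (c1 / (c1 + 1)).
  by field; rewrite gt_eqF.
apply: ler_piMr; first by rewrite divr_ge0 ?(ltW e0).
by rewrite ler_pdivrMr// mul1r lerDl.
Qed.

End SchurTest.

(** * The adjoint as the Schur map of the conjugate transpose *)

Section Adjoint.
Variables (R : realType) (H : completeNormedModType R[i]).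
Variable dot : {dot H for Num.conj}.
Hypothesis dotE : forall x : H, dot x x = `|x| ^+ 2.
Variable A : set (H -> H).
Hypotheses (vnA : von_neumann_algebra dot A) (comA : commutative_algebra A).
Implicit Types (x y z : H) (a b : nat -> H -> H).

Local Notation rdt := (rdot dot).

Variables (m : nat -> nat -> H -> H) (q : nat -> nat -> H -> R) (Bc Br : R).
Hypotheses (mA : forall j k, A (m j k)) (Bc0 : 0 < Bc) (Br0 : 0 < Br).
Hypothesis q0 : forall j k x, 0 <= q j k x.
Hypothesis q_schwarz : forall j k (t : R) v y, 0 < t ->
  2 * `|rdt (m j k v) y| <= t * q j k v + t^-1 * q j k y.
Hypothesis q_col : forall k n x, \sum_(0 <= j < n) q j k x <= Bc * rnorm x ^+ 2.
Hypothesis q_row : forall j n x, \sum_(0 <= k < n) q j k x <= Br * rnorm x ^+ 2.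

(** Tested on x and y, the two module inner products are the iterated sums of <m_jk a_k x, b_j y> in
    the two orders. *)
Lemma schur_adjointable : adjointable dot A (schur m).
Proof.
pose m' k j := adjoint dot (m j k).
have m'A k j : A (m' k j) by apply: (vn_adj dotE vnA).
(* Passing to the adjoint swaps v and y, which is compensated by replacing t with its inverse. *)
have m'_schwarz k j (t : R) v y : 0 < t ->
    2 * `|rdt (m' k j v) y| <= t * q j k v + t^-1 * q j k y.
  move=> t0; rewrite /m' (vn_rdotl dotE vnA (mA j k)) rdotC addrC.
  by rewrite -{2}[t]invrK; apply: q_schwarz; rewrite invr_gt0.
have series a j (la : l2strong dot A a) :=
  schur_series dotE vnA comA mA Br0 q0 q_schwarz q_row j la.
have series' b k (lb : l2strong dot A b) :=
  schur_series dotE vnA comA m'A Bc0 (fun k j => q0 j k) m'_schwarz q_col k lb.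
have ls a (la : l2strong dot A a) :=
  schur_l2strong dotE vnA comA mA Bc0 Br0 q0 q_schwarz q_col q_row la.
have ls' b (lb : l2strong dot A b) :=
  schur_l2strong dotE vnA comA m'A Br0 Bc0 (fun k j => q0 j k) m'_schwarz q_row q_col lb.
split; first exact: ls.
exists (schur m') => [b lb|a b la lb]; first exact: ls'.
apply/funext => x; apply: (rdot_inj dotE) => y.
have Aa k := l2strong_vn k la; have Ab k := l2strong_vn k lb.
have hX := sot_series_rdot (x := x) (y := y) dotE
  (l2strong_ip_series dotE vnA comA (ls _ la) lb).
have hY := sot_series_rdot (x := x) (y := y) dotE
  (l2strong_ip_series dotE vnA comA la (ls' _ lb)).
apply: (iterated_series_eq (c := fun j k => rdt (m j k (a k x)) (b j y)) _ _ hX hY).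
- move=> j; rewrite (rdot_comp_adjoint dotE vnA comA)//; last exact: l2strong_vn (ls _ la).
  exact: (sot_series_rdot (x := x) (y := b j y) dotE (series a j la)).
- move=> k; rewrite (rdot_comp_adjoint dotE vnA comA)//; last exact: l2strong_vn (ls' _ lb).
  rewrite rdotC.
  have := sot_series_rdot (x := y) (y := a k x) dotE (series' b k lb).
  suff -> : (fun n => \sum_(0 <= j < n) rdt ((m' k j \o b j) y) (a k x)) =
    (fun n => \sum_(0 <= j < n) rdt (m j k (a k x)) (b j y)) by [].
  apply/funext => n; apply: eq_bigr => j _ /=.
  by rewrite (vn_rdotl dotE vnA (mA j k)) rdotC.
move=> e e0.
have [_ [Ka Ka0 hKa]] := (l2strongP dotE vnA comA a).1 la.
have [_ [Kb Kb0 hKb]] := (l2strongP dotE vnA comA b).1 lb.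
(* M bounds the weights of b whatever the block, so t is first taken large enough for M / t <= e.
   Then N makes the tail of |a_k x|^2 at most e / (t Bc), so that the weights of a contribute at
   most e; together 2 |block| <= 2 e. *)
pose M := Br * (Kb * rnorm y ^+ 2).
have M0 : 0 <= M by rewrite (mulr_ge0 (ltW Br0))// mulr_ge0 ?sqr_ge0.
pose t := (M + 1) / e; have t0 : 0 < t by rewrite divr_gt0// ltr_wpDl.
have d0 : 0 < e / (t * Bc) by rewrite divr_gt0// mulr_gt0.
have [N hN] := bounded_sum_tail (fun k => sqr_ge0 (rnorm (a k x)))
  (fun n => hKa n x) d0.
exists N => i l n Ni.
have h : 2 * `|\sum_(0 <= j < n) \sum_(i <= k < l) rdt (m j k (a k x)) (b j y)| <=
    t * (\sum_(0 <= j < n) \sum_(i <= k < l) q j k (a k x)) +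
    t^-1 * (\sum_(0 <= j < n) \sum_(i <= k < l) q j k (b j y)).
  rewrite !mulr_sumr -big_split /=.
  apply: le_trans (_ : 2 * (\sum_(0 <= j < n) \sum_(i <= k < l)
      `|rdt (m j k (a k x)) (b j y)|) <= _).
    rewrite ler_pM2l//; apply: le_trans (ler_norm_sum _ _ _) _.
    by apply: ler_sum => j _; exact: ler_norm_sum.
  rewrite mulr_sumr; apply: ler_sum => j _.
  rewrite !mulr_sumr -big_split /=; apply: ler_sum => k _.
  exact: q_schwarz.
have h1 : t * (\sum_(0 <= j < n) \sum_(i <= k < l) q j k (a k x)) <= e.
  rewrite exchange_big_nat /=.
  apply: (@le_trans _ _ (t * (Bc * \sum_(i <= k < l) rnorm (a k x) ^+ 2))).
    rewrite ler_pM2l// mulr_sumr; apply: ler_sum => k _; exact: q_col.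
  by rewrite mulrA [leLHS]mulrC -ler_pdivlMr ?(mulr_gt0 t0)//; exact: hN.
have h2 : t^-1 * (\sum_(0 <= j < n) \sum_(i <= k < l) q j k (b j y)) <= e.
  rewrite mulrC ler_pdivrMr// /t mulrC divfK ?gt_eqF//.
  apply: (@le_trans _ _ M); last by rewrite lerDl.
  apply: (@le_trans _ _ (Br * vsum b n y)); last by rewrite ler_pM2l//; exact: hKb.
  rewrite /vsum mulr_sumr; apply: ler_sum => j _.
  exact: (schur_row_block Br0 q0 q_row).
by lra.
Qed.

End Adjoint.

Theorem proposition4p4 (R : realType) (H : completeNormedModType R[i])
    (dot : {dot H for Num.conj})
    (dotE : forall x : H, dot x x = `|x| ^+ 2)
    (A : set (H -> H))
    (vnA : von_neumann_algebra dot A) (comA : commutative_algebra A)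
    (m : nat -> nat -> H -> H) (mA : forall j k, A (m j k))
    (Bc Br : R) (Bc_gt0 : 0 < Bc) (Br_gt0 : 0 < Br) :
  let p := fun j k => abs_op dot (m j k) in
  (forall k, (exists S, sot_series (fun j => p j k) S) /\
     (opnorm (sot_sum (fun j => p j k)) <= Bc%:E)%E) ->
  (forall j, (exists S, sot_series (fun k => p j k) S) /\
     (opnorm (sot_sum (fun k => p j k)) <= Br%:E)%E) ->
  [/\ forall a, l2 dot A a ->
        forall j, exists S, norm_series (fun k => m j k \o a k) S,
      module_map A (l2 dot A) (l2strong dot A) (matrix_map m),
      (map_norm (l2 dot A) (l2_norm dot) (l2strong_norm dot) (matrix_map m)
         < +oo)%E &
      exists L : (nat -> H -> H) -> (nat -> H -> H),
        [/\ forall a, l2 dot A a -> L a = matrix_map m a,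
            adjointable dot A L &
            (map_norm (l2strong dot A) (l2strong_norm dot) (l2strong_norm dot) L
               <= (Num.sqrt (Br * Bc))%:E)%E] ].
Proof.
move=> p hc hr.
have absP j k := abs_opP dotE vnA (mA j k).
pose q j k x := rdot dot (p j k x) x.
have sp j k : selfadj dot (p j k) by apply: positive_selfadj; case: (absP j k).
have q0 j k x : 0 <= q j k x.
  by have [_ [_ pp] _] := absP j k; have := pp x; rewrite lecE => /andP[].
have q_schwarz j k (t : R) v y : 0 < t ->
    2 * `|rdot dot (m j k v) y| <= t * q j k v + t^-1 * q j k y.
  have [Ap pp np] := absP j k; apply: (mixed_schwarz dotE) => //.
    exact: (vn_blinear vnA).
  by move=> x; apply: (vn_comm comA).
have q_col k n x : \sum_(0 <= j < n) q j k x <= Bc * rnorm x ^+ 2.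
  have [[S hS]] := hc k; rewrite (sot_sumE hS).
  by move/(sot_positive_opnorm dotE hS (sp^~ k) (q0^~ k) (ltW Bc_gt0)); apply.
have q_row j n x : \sum_(0 <= k < n) q j k x <= Br * rnorm x ^+ 2.
  have [[S hS]] := hr j; rewrite (sot_sumE hS).
  by move/(sot_positive_opnorm dotE hS (sp j) (q0 j) (ltW Br_gt0)); apply.
have ext a : l2 dot A a -> schur m a = matrix_map m a.
  exact: (schur_matrix_map dotE vnA comA mA Br_gt0 q0 q_schwarz q_row).
have bound := schur_norm_le dotE vnA comA mA Bc_gt0 Br_gt0 q0 q_schwarz q_col q_row.
split.
- move=> a la j.
  exact: (schur_norm_series dotE vnA comA mA Br_gt0 q0 q_schwarz q_row j la).
- exact: (matrix_map_module dotE vnA comA mA Bc_gt0 Br_gt0 q0 q_schwarz q_col q_row).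
(* On l2 both norms and both maps agree, so this supremum runs over part of the unit ball of
   l2strong. *)
- apply: le_lt_trans (ltry (Num.sqrt (Br * Bc))); apply: le_trans bound.
  apply: ge_ereal_sup => _ [a [la na] <-]; apply: ereal_sup_ubound.
  have [ls eqn] := l2_l2strong dotE vnA comA la.
  by exists a; [split=> //; rewrite -eqn | rewrite ext].
- exists (schur m); split=> //.
  exact: (schur_adjointable dotE vnA comA mA Bc_gt0 Br_gt0 q0 q_schwarz q_col q_row).
Qed.
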